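(* Let $\alpha\ge 0$, let $A$ be the generator of a tempered $\alpha$-times integrated semigroup $(T_\alpha(t))_{t\ge 0}\subseteq\mathcal{B}(X)$ on a complex Banach space $X$, and let $0<\sigma<1$. Then, for every $f\in\mathcal{D}(A)$, $$ (-A)^\sigma f=\frac{\Gamma(\sigma+\alpha+1)}{\Gamma(-\sigma)\Gamma(1+\sigma)}\int_0^\infty\left(T_\alpha(t)f-\frac{t^\alpha}{\Gamma(\alpha+1)}\,f\right)\frac{dt}{t^{\sigma+\alpha+1}}. $$
   Context: $\mathcal{B}(X)$ is the Banach algebra of bounded operators on the Banach space $(X,\|\cdot\|)$. $\mathcal{D}(A)$ denotes the domain of $A$. Tempered integrated semigroup: let $\alpha\ge 0$ and let $(T_\alpha(t))_{t\ge 0}\subseteq\mathcal{B}(X)$ be strongly continuous on $[0,\infty)$ with $\sup_{t>0}t^{-\alpha}\|T_\alpha(t)\|<\infty$. Suppose there exists a (unique) closed and densely defined operator $A$ on $X$ such that $\lambda-A$ is invertible whenever $\Re\lambda>0$, with $$(\lambda-A)^{-1}f=\lambda^\alpha\int_0^\infty e^{-\lambda t}T_\alpha(t)f\,dt,\qquad \Re\lambda>0,\ f\in X.$$ Then $(T_\alpha(t))_{t\ge 0}$ is called a (globally) tempered $\alpha$-times integrated semigroup and $A$ its generator. Fractional power (Balakrishnan): for $0<\sigma<1$ and $f\in\mathcal{D}(A)$, $$(-A)^\sigma f=\frac{\sin(\pi\sigma)}{\pi}\int_0^\infty\lambda^{\sigma-1}(\lambda-A)^{-1}(-Af)\,d\lambda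 .$$ *)

(* Defs.v *)
From Stdlib Require Import Reals Lra Lia.
From Coquelicot Require Import Coquelicot.
Open Scope R_scope.

Definition Cexp (z : C) : C :=
  (exp (Re z) * cos (Im z), exp (Re z) * sin (Im z)).

(* Principal branch of z^a, for Re z > 0 only: there Arg z = atan (Im z / Re z). *)
Definition Cpower (z : C) (a : R) : C :=
  Cexp (a * ln (Cmod z), a * atan (Im z / Re z)).

Definition Euler_integral (x : R) : R :=
  RInt_gen (fun t : R => Rpower t (x - 1) * exp (- t))
    (at_right 0) (Rbar_locally p_infty).

Fixpoint Gamma_shift (n : nat) (x : R) : R :=
  match n with
  | O => Euler_integral x
  | S m => Gamma_shift m (x + 1) / x
  end.

(* For non-integer x < 0, [Z.to_nat (up (- x))] is the least n with x + n > 0, and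
   Gamma is extended from (0, +oo) by Gamma x = Gamma (x + 1) / x.  The values at
   the poles 0, -1, -2, ... are meaningless. *)
Definition Gamma (x : R) : R := Gamma_shift (Z.to_nat (up (- x))) x.

Lemma Gamma_pos (x : R) : 0 < x -> Gamma x = Euler_integral x.
Proof.
intros Hx; unfold Gamma.
destruct (archimed (- x)) as [_ H].
assert (Hu : (up (- x) < 1)%Z) by (apply lt_IZR; simpl; lra).
replace (Z.to_nat (up (- x))) with O by lia.
reflexivity.
Qed.

Lemma Gamma_neg (x : R) : -1 < x < 0 -> Gamma x = Gamma (x + 1) / x.
Proof.
intros Hx; rewrite (Gamma_pos (x + 1)) by lra; unfold Gamma.
rewrite <- (tech_up (- x) 1) by (simpl; lra).
reflexivity.
Qed.

(* Coquelicot integrates functions with values in normed modules over R; the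
   carrier, uniform structure and norm of X are unchanged. *)
Section RealScalars.

Variable X : CompleteNormedModule C_AbsRing.

Lemma real_scal_assoc (a b : R) (u : X) :
  scal (RtoC a) (scal (RtoC b) u) = scal (RtoC (a * b)) u.
Proof. rewrite scal_assoc, RtoC_mult; reflexivity. Qed.

Lemma real_scal_one (u : X) : scal (RtoC 1) u = u.
Proof. exact (scal_one u). Qed.

Lemma real_scal_distr_l (a : R) (u v : X) :
  scal (RtoC a) (plus u v) = plus (scal (RtoC a) u) (scal (RtoC a) v).
Proof. exact (scal_distr_l (RtoC a) u v). Qed.

Lemma real_scal_distr_r (a b : R) (u : X) :
  scal (RtoC (a + b)) u = plus (scal (RtoC a) u) (scal (RtoC b) u).
Proof. rewrite RtoC_plus; exact (scal_distr_r (RtoC a) (RtoC b) u). Qed.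

Definition real_ModuleSpace_mixin : ModuleSpace.mixin_of R_Ring X :=
  ModuleSpace.Mixin R_Ring X (fun (a : R) (u : X) => scal (RtoC a) u)
    real_scal_assoc real_scal_one real_scal_distr_l real_scal_distr_r.

Definition real_NormedModuleAux : NormedModuleAux R_AbsRing :=
  NormedModuleAux.Pack R_AbsRing X
    (NormedModuleAux.Class R_AbsRing X
      (ModuleSpace.Class R_Ring X (AbelianGroup.class X) real_ModuleSpace_mixin)
      (UniformSpace.class X)) X.

Lemma real_norm_scal (a : R) (u : X) :
  norm (scal (RtoC a) u) <= Rabs a * norm u.
Proof. rewrite <- Cmod_R; exact (norm_scal (RtoC a) u). Qed.

Definition real_NormedModule_mixin :
    NormedModule.mixin_of R_AbsRing real_NormedModuleAux :=
  NormedModule.Mixin R_AbsRing real_NormedModuleAux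
    (fun u : X => norm u) (@norm_factor C_AbsRing X)
    (@norm_triangle C_AbsRing X) real_norm_scal
    (@norm_compat1 C_AbsRing X) (@norm_compat2 C_AbsRing X)
    (@norm_eq_zero C_AbsRing X).

Definition real_space : CompleteNormedModule R_AbsRing :=
  CompleteNormedModule.Pack R_AbsRing X
    (CompleteNormedModule.Class R_AbsRing X
      (NormedModule.Class R_AbsRing X
        (NormedModuleAux.class R_AbsRing real_NormedModuleAux)
        real_NormedModule_mixin)
      (CompleteSpace.mixin X (CompleteSpace.class X))) X.

End RealScalars.

Definition integral {X : CompleteNormedModule C_AbsRing} (g : R -> X) : X :=
  RInt_gen (V := real_space X) g (at_right 0) (Rbar_locally p_infty).

Definition abs_convergent {X : CompleteNormedModule C_AbsRing} (g : R -> X) : Prop :=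
  ex_RInt_gen (V := real_space X) g (at_right 0) (Rbar_locally p_infty) /\
  ex_RInt_gen (fun t : R => norm (g t)) (at_right 0) (Rbar_locally p_infty).

(* The values of [op] outside [dom] are irrelevant. *)
Record operator (X : CompleteNormedModule C_AbsRing) := Operator {
  dom : X -> Prop;
  op :> X -> X;
  dom_zero : dom zero;
  dom_plus : forall u v : X, dom u -> dom v -> dom (plus u v);
  dom_scal : forall (c : C) (u : X), dom u -> dom (scal c u);
  op_plus : forall u v : X, dom u -> dom v -> op (plus u v) = plus (op u) (op v);
  op_scal : forall (c : C) (u : X), dom u -> op (scal c u) = scal c (op u)
}.

Arguments dom {X} o _.
Arguments op {X} o _.

Definition closed_operator {X : CompleteNormedModule C_AbsRing} (A : operator X) : Prop :=
  closed (fun p : X * X => dom A (fst p) /\ snd p = A (fst p)).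

Definition densely_defined {X : CompleteNormedModule C_AbsRing} (A : operator X) : Prop :=
  forall (x : X) (eps : posreal), exists u : X, dom A u /\ ball x eps u.

(* Coquelicot's [is_linear] includes boundedness. *)
Definition in_resolvent_set {X : CompleteNormedModule C_AbsRing}
    (A : operator X) (lambda : C) : Prop :=
  exists S : X -> X,
    is_linear S /\
    (forall f : X, dom A (S f) /\ minus (scal lambda (S f)) (A (S f)) = f) /\
    (forall u : X, dom A u -> S (minus (scal lambda u) (A u)) = u).

(* (lambda - A)^-1 f, as the solution u of (lambda - A) u = f; meaningful for
   lambda in the resolvent set, where the solution is unique. *)
Definition resolvent {X : CompleteNormedModule C_AbsRing}
    (A : operator X) (lambda : C) (f : X) : X :=
  iota (fun u : X => dom A u /\ minus (scal lambda u) (A u) = f).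

Lemma resolvent_spec {X : CompleteNormedModule C_AbsRing}
    (A : operator X) (lambda : C) (f : X) :
  in_resolvent_set A lambda ->
  dom A (resolvent A lambda f) /\
  minus (scal lambda (resolvent A lambda f)) (A (resolvent A lambda f)) = f.
Proof.
intros [S [_ [H1 H2]]].
apply (iota_correct (fun u : X => dom A u /\ minus (scal lambda u) (A u) = f)).
exists (S f); split; [exact (H1 f)|].
intros u [Hu <-]; exact (H2 u Hu).
Qed.

Definition op_norm {X : CompleteNormedModule C_AbsRing} (T : X -> X) : R :=
  real (Lub_Rbar (fun r : R => exists x : X, norm x <= 1 /\ r = norm (T x))).

Definition tempered_family {X : CompleteNormedModule C_AbsRing}
    (alpha : R) (T : R -> X -> X) : Prop :=
  (forall t : R, 0 <= t -> is_linear (T t)) /\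
  (forall f : X, continuous_on (fun t : R => 0 <= t) (fun t : R => T t f)) /\
  (exists M : R, forall t : R, 0 < t -> Rpower t (- alpha) * op_norm (T t) <= M).

(* A generates the tempered alpha-times integrated semigroup (T t)_{t >= 0}; the
   values of T at t < 0 are irrelevant. *)
Definition generates_tempered {X : CompleteNormedModule C_AbsRing}
    (alpha : R) (A : operator X) (T : R -> X -> X) : Prop :=
  tempered_family alpha T /\
  closed_operator A /\
  densely_defined A /\
  (forall lambda : C, 0 < Re lambda ->
    in_resolvent_set A lambda /\
    forall f : X,
      resolvent A lambda f =
      scal (Cpower lambda alpha)
        (integral (fun t : R => scal (Cexp (- (lambda * RtoC t))%C) (T t f)))).

Definition balakrishnan_integrand {X : CompleteNormedModule C_AbsRing}
    (A : operator X) (sigma : R) (f : X) (lambda : R) : X :=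
  scal (RtoC (Rpower lambda (sigma - 1))) (resolvent A (RtoC lambda) (opp (A f))).

(* (- A)^sigma f, for 0 < sigma < 1 and f in the domain of A. *)
Definition frac_power {X : CompleteNormedModule C_AbsRing}
    (A : operator X) (sigma : R) (f : X) : X :=
  scal (RtoC (sin (PI * sigma) / PI)) (integral (balakrishnan_integrand A sigma f)).

(* Main.v *)
(** Put g(t) = T(t) f - t^alpha / Gamma(alpha+1) f and s = sigma + alpha + 1.  Since
    f = lambda R f - R A f for the resolvent R at lambda, g and t |-> int_0^t T(r) A f dr have
    the same Laplace transform, hence coincide.  So g is bounded by multiples of both t^alpha
    and t^(alpha+1), its Laplace transform is lambda^(-alpha-1) R A f, and the Balakrishnan
    integrand is - lambda^(s-1) int_0^oo e^(-lambda t) g(t) dt.  Integrating in lambda under the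
    integral sign turns lambda^(s-1) e^(-lambda t) into Gamma(s) t^(-s); the constant is then
    Euler's reflection formula.

    There is no Fubini theorem for vector-valued improper Riemann integrals to appeal to:
    instead, the primitive in lambda of lambda^(s-1) e^(-lambda t) is integrated against g and
    differentiated in lambda, every error being bounded by a multiple of t^(-q) with
    alpha+1 < q < alpha+2, and t^(-q) g(t) is absolutely integrable. *)
Require Import Defs.
From Stdlib Require Import Reals Lra Lia.
From Coquelicot Require Import Coquelicot.
Open Scope R_scope.

(** * Linear identities in normed modules *)

(** The bound by [t^alpha] alone makes [t^(-s) g(t)] of order [t^(-sigma-1)], which is integrable at
    infinity but not at 0; there the bound by [t^(alpha+1)] gives [t^(-sigma)]. This gain of one
    power is what the uniqueness of Laplace transforms buys. So [s] lies strictly between [alpha+1]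
    and [alpha+2], at distances [sigma] and [1-sigma] from the ends, and this slack pays for every
    error term.

    All convergence is reduced to one criterion: a continuous function on the half-line dominated
    both by [t^(p-1)] and by [t^(-p-1)], for one [p > 0], is integrable with an explicit truncation
    error. The bounds come from [exp (- t) <= q^q t^(-q)], where [q] is chosen separately for each
    end. Explicit errors are kept because they must be uniform in a parameter when a limit or a
    derivative passes under the integral sign.

    The reflection formula combines Wendel's inequality [Gamma (x + s) <= x^s Gamma x] with the
    cosine integrals behind Euler's sine product. *)

Inductive vexpr : Type :=
  | VZero
  | VVar (n : nat)
  | VPlus (e1 e2 : vexpr)
  | VOpp (e : vexpr)
  | VScal (k : R) (e : vexpr).

Section LinearExpressions.

Context {V : NormedModule R_AbsRing}.

Fixpoint vdenote (env : list V) (e : vexpr) : V :=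
  match e with
  | VZero => zero
  | VVar n => List.nth n env zero
  | VPlus e1 e2 => plus (vdenote env e1) (vdenote env e2)
  | VOpp e => opp (vdenote env e)
  | VScal k e => scal k (vdenote env e)
  end.

Fixpoint vcoef (e : vexpr) (m : nat) : R :=
  match e with
  | VZero => 0
  | VVar n => if Nat.eqb n m then 1 else 0
  | VPlus e1 e2 => vcoef e1 m + vcoef e2 m
  | VOpp e => - vcoef e m
  | VScal k e => k * vcoef e m
  end.

Fixpoint vcomb (env : list V) (c : nat -> R) : V :=
  match env with
  | nil => zero
  | (v :: env)%list => plus (scal (c O) v) (vcomb env (fun n => c (S n)))
  end.

Lemma vcomb_ext (env : list V) (c d : nat -> R) :
  (forall n, (n < length env)%nat -> c n = d n) -> vcomb env c = vcomb env d.
Proof.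
  revert c d. induction env as [|v env IH]; simpl; intros c d H; [reflexivity|].
  rewrite (H O) by lia. f_equal. apply IH. intros n Hn. apply H. lia.
Qed.

Lemma vcomb_zero (env : list V) : vcomb env (fun _ => 0) = zero.
Proof.
  induction env as [|v env IH]; simpl; [reflexivity|].
  rewrite IH, plus_zero_r. apply (scal_zero_l v).
Qed.

Lemma vcomb_plus (env : list V) (c d : nat -> R) :
  vcomb env (fun n => c n + d n) = plus (vcomb env c) (vcomb env d).
Proof.
  revert c d. induction env as [|v env IH]; simpl; intros c d.
  - symmetry. apply plus_zero_l.
  - rewrite (IH (fun n => c (S n)) (fun n => d (S n))).
    rewrite (scal_distr_r (c O) (d O) v : scal (c O + d O) v = _).
    rewrite <- !plus_assoc. f_equal. rewrite !plus_assoc. f_equal. apply plus_comm.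
Qed.

Lemma vcomb_scal (env : list V) (k : R) (c : nat -> R) :
  vcomb env (fun n => k * c n) = scal k (vcomb env c).
Proof.
  revert c. induction env as [|v env IH]; simpl; intros c.
  - symmetry. exact (@scal_zero_r R_Ring (NormedModule.ModuleSpace R_AbsRing V) k).
  - rewrite (IH (fun n => c (S n))), scal_distr_l. f_equal.
    symmetry. apply (scal_assoc k (c O) v).
Qed.

Lemma vcomb_var (env : list V) (n : nat) :
  (n < length env)%nat ->
  vcomb env (fun m => if Nat.eqb n m then 1 else 0) = List.nth n env zero.
Proof.
  revert n. induction env as [|v env IH]; simpl; intros n Hn; [lia|].
  destruct n as [|n]; simpl.
  - rewrite vcomb_zero, plus_zero_r. apply (scal_one v).
  - rewrite IH by lia.
    etransitivity; [apply (f_equal (fun w => plus w _)), (scal_zero_l v)|]. apply plus_zero_l.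
Qed.

Fixpoint vclosed (n : nat) (e : vexpr) : bool :=
  match e with
  | VZero => true
  | VVar m => Nat.ltb m n
  | VPlus e1 e2 => andb (vclosed n e1) (vclosed n e2)
  | VOpp e => vclosed n e
  | VScal _ e => vclosed n e
  end.

Lemma vdenote_vcomb (env : list V) (e : vexpr) :
  vclosed (length env) e = true -> vdenote env e = vcomb env (vcoef e).
Proof.
  induction e; simpl; intros H.
  - symmetry. apply vcomb_zero.
  - symmetry. apply vcomb_var. apply Nat.ltb_lt, H.
  - apply andb_prop in H. rewrite IHe1, IHe2 by apply H. symmetry. apply vcomb_plus.
  - rewrite IHe by exact H.
    transitivity (scal (-1) (vcomb env (vcoef e))); [symmetry; exact (scal_opp_one _)|].
    rewrite <- vcomb_scal. apply vcomb_ext. intros. ring.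
  - rewrite IHe by exact H. symmetry. apply vcomb_scal.
Qed.

(** Equality of real coefficients does not compute, so it is unfolded into a conjunction left to
    [ring] or [field]; only the scoping test [vclosed] is boolean and settled by [eq_refl]. *)
Fixpoint vagree (n : nat) (e1 e2 : vexpr) : Prop :=
  match n with
  | O => True
  | S n => vcoef e1 n = vcoef e2 n /\ vagree n e1 e2
  end.

Lemma vexpr_eq (env : list V) (e1 e2 : vexpr) :
  vclosed (length env) e1 = true -> vclosed (length env) e2 = true ->
  vagree (length env) e1 e2 -> vdenote env e1 = vdenote env e2.
Proof.
  intros H1 H2 H. rewrite !vdenote_vcomb by assumption. apply vcomb_ext.
  revert H. generalize (length env). induction n as [|n IH]; simpl; intros H m Hm.
  - lia.
  - destruct H as [H3 H4]. destruct (Nat.eq_dec m n) as [-> | Hmn]; [exact H3|]. apply IH; [exact H4|lia].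
Qed.

End LinearExpressions.

Ltac vlookup x env :=
  lazymatch env with
  | nil => constr:(O)
  | (x :: _)%list => constr:(O)
  | (_ :: ?env')%list => let n := vlookup x env' in constr:(S n)
  end.

Ltac vadd x env :=
  lazymatch env with
  | nil => constr:((x :: env)%list)
  | (x :: _)%list => env
  | (?y :: ?env')%list => let e := vadd x env' in constr:((y :: e)%list)
  end.

Ltac vvars t env :=
  lazymatch t with
  | @plus _ ?a ?b => let env := vvars a env in vvars b env
  | @minus _ ?a ?b => let env := vvars a env in vvars b env
  | @opp _ ?a => vvars a env
  | @scal _ _ _ ?a => vvars a env
  | @zero _ => env
  | _ => vadd t env
  end.

Ltac vreify t env :=
  lazymatch t with
  | @plus _ ?a ?b =>
      let a := vreify a env in let b := vreify b env in constr:(VPlus a b)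
  | @minus _ ?a ?b =>
      let a := vreify a env in let b := vreify b env in constr:(VPlus a (VOpp b))
  | @opp _ ?a => let a := vreify a env in constr:(VOpp a)
  | @scal _ _ ?k ?a => let a := vreify a env in constr:(VScal k a)
  | @zero _ => constr:(VZero)
  | _ => let n := vlookup t env in constr:(VVar n)
  end.

(* Reduces an equation between linear combinations in a real normed module [V] to
   the equality of the coefficients of each atom. *)
Ltac vlinear V :=
  lazymatch goal with
  | |- ?l = ?r =>
      let env := vvars l (@nil V) in
      let env := vvars r env in
      let l' := vreify l env in
      let r' := vreify r env in
      refine (@vexpr_eq V env l' r' eq_refl eq_refl _); cbn [length vagree vcoef Nat.eqb];
      repeat split
  end.

(** * Improper integrals over the half-line *)

Notation is_int f l := (is_RInt_gen f (at_right 0) (Rbar_locally p_infty) l).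

(** * Real powers near 0 and near infinity *)

Lemma Rpower_pos (x p : R) : 0 < Rpower x p.
Proof. apply exp_pos. Qed.

Lemma Rpower_sub_1 (x p : R) : 0 < x -> Rpower x (p - 1) = Rpower x p / x.
Proof.
  intros Hx. replace (p - 1) with (p + - (1)) by ring.
  rewrite Rpower_plus, Rpower_Ropp, Rpower_1 by assumption. reflexivity.
Qed.

Lemma Rpower_add_1 (x p : R) : 0 < x -> Rpower x (p + 1) = x * Rpower x p.
Proof.
  intros Hx. rewrite Rpower_plus, Rpower_1 by assumption. ring.
Qed.

Lemma is_derive_Rpower (x p : R) :
  0 < x -> is_derive (fun t => Rpower t p) x (p * Rpower x (p - 1)).
Proof. intros Hx. apply is_derive_Reals, derivable_pt_lim_power, Hx. Qed.

Lemma continuous_Rpower (x p : R) : 0 < x -> continuous (fun t => Rpower t p) x.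
Proof.
  intros Hx. apply (ex_derive_continuous (fun t => Rpower t p)).
  exists (p * Rpower x (p - 1)). apply is_derive_Rpower, Hx.
Qed.

(** For [t >= 1] the smaller exponent [u] gives the stronger bound, for [t < 1] the larger exponent
    [v] does; either way the better one implies the bound with [c]. *)
Lemma Rpower_interpolation (C y t u v c : R) :
  0 <= C -> 0 < t -> u <= c <= v ->
  y <= C * Rpower t u -> y <= C * Rpower t v -> y <= C * Rpower t c.
Proof.
  intros HC Ht Hc Hu Hv.
  destruct (Rle_lt_dec 1 t) as [H | H].
  - apply Rle_trans with (1 := Hu). apply Rmult_le_compat_l; [exact HC|].
    apply Rle_Rpower; lra.
  - apply Rle_trans with (1 := Hv). apply Rmult_le_compat_l; [exact HC|].
    unfold Rpower. assert (Hl : ln t < 0) by (rewrite <- ln_1; apply ln_increasing; lra).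
    destruct (Req_dec c v) as [<- | Hn]; [lra|].
    left. apply exp_increasing. nra.
Qed.

Lemma Rpower_filterlim_0 (p : R) :
  0 < p -> filterlim (fun t => Rpower t p) (at_right 0) (locally 0).
Proof.
  intros Hp. apply filterlim_locally. intros eps.
  exists (mkposreal _ (Rpower_pos eps (/ p))). intros t Ht Ht0.
  change (Rabs (Rpower t p - 0) < eps).
  change (Rabs (t - 0) < Rpower eps (/ p)) in Ht.
  rewrite Rminus_0_r in *. rewrite Rabs_pos_eq in Ht by lra.
  rewrite Rabs_pos_eq by (left; apply Rpower_pos).
  replace (pos eps) with (Rpower (Rpower eps (/ p)) p).
  - apply Rlt_Rpower_l; lra.
  - rewrite Rpower_mult, Rinv_l, Rpower_1; try lra. apply eps.
Qed.

Lemma Rpower_filterlim_infty (p : R) :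
  0 < p -> filterlim (fun t => Rpower t (- p)) (Rbar_locally p_infty) (locally 0).
Proof.
  intros Hp. apply filterlim_ext_loc with (fun t => Rpower (/ t) p).
  - exists 0. intros t Ht. unfold Rpower. rewrite ln_Rinv by exact Ht. f_equal; ring.
  - apply (filterlim_comp _ _ _ Rinv (fun t => Rpower t p) _ (at_right 0));
      [|apply Rpower_filterlim_0, Hp].
    intros P [e He]. exists (/ e). intros x Hx.
    assert (He0 := cond_pos e). assert (0 < / e) by (apply Rinv_0_lt_compat, He0).
    apply He.
    + change (Rabs (/ x - 0) < e). rewrite Rminus_0_r, Rabs_pos_eq.
      * rewrite <- (Rinv_inv e). apply Rinv_lt_contravar; [apply Rmult_lt_0_compat; lra|exact Hx].
      * left. apply Rinv_0_lt_compat. lra.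
    + apply Rinv_0_lt_compat. lra.
Qed.

(** * Convergence of vector-valued improper integrals *)

Section HalfLine.

Context {V : CompleteNormedModule R_AbsRing}.
Implicit Types f g : R -> V.

(* Restated so that [opp] is elaborated through the [CompleteNormedModule] instance. *)
Lemma norm_opp_complete (u : V) : norm (opp u) = norm u.
Proof. exact (norm_opp u). Qed.

Lemma norm_scal_eq (k : R) (u : V) : norm (scal k u) = Rabs k * norm u.
Proof.
  apply Rle_antisym; [exact (norm_scal k u)|].
  destruct (Req_dec k 0) as [-> | Hk].
  - rewrite Rabs_R0, Rmult_0_l. apply norm_ge_0.
  - assert (Hk' := Rabs_pos_lt k Hk).
    assert (H := norm_scal (/ k) (scal k u)).
    change (abs (/ k)) with (Rabs (/ k)) in H. rewrite Rabs_inv in H.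
    apply Rmult_le_reg_l with (/ Rabs k); [apply Rinv_0_lt_compat, Hk'|].
    rewrite <- Rmult_assoc, Rinv_l, Rmult_1_l by lra.
    apply Rle_trans with (2 := H). right. f_equal. vlinear V. field. exact Hk.
Qed.

Lemma norm_minus_le (u v w : V) :
  norm (minus u w) <= norm (minus u v) + norm (minus w v).
Proof.
  replace (minus u w) with (plus (minus u v) (opp (minus w v))) by (vlinear V; ring).
  rewrite <- (norm_opp_complete (minus w v)). apply (norm_triangle (minus u v)).
Qed.

Lemma half_line_exhaustion (a b : R) :
  0 < a ->
  filter_prod (at_right 0) (Rbar_locally p_infty)
    (fun ab => 0 < fst ab <= a /\ b <= snd ab).
Proof.
  intros Ha. apply Filter_prod with (fun x => 0 < x < a) (fun x => b < x).
  - exists (mkposreal a Ha). intros x Hx Hx0.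
    change (Rabs (x - 0) < a) in Hx. rewrite Rminus_0_r, Rabs_pos_eq in Hx; lra.
  - exists b. auto.
  - simpl. intros. lra.
Qed.

Lemma half_line_ordered :
  filter_prod (at_right 0) (Rbar_locally p_infty) (fun ab => 0 < fst ab <= snd ab).
Proof.
  generalize (half_line_exhaustion 1 1 Rlt_0_1). apply filter_imp. intros ab H. lra.
Qed.

Lemma ex_RInt_half_line f (a b : R) :
  (forall t, 0 < t -> continuous f t) -> 0 < a -> 0 < b -> ex_RInt f a b.
Proof.
  intros Hf Ha Hb. apply (ex_RInt_continuous f). intros t Ht. apply Hf.
  apply Rlt_le_trans with (2 := proj1 Ht). apply Rmin_case; assumption.
Qed.

(** Continuity makes every inner integral exist, so the relational limit inside [is_RInt_gen]
    becomes the limit of a function, to which Cauchy and comparison arguments apply. *)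
Lemma is_RInt_gen_filterlim f (l : V) :
  (forall t, 0 < t -> continuous f t) ->
  is_int f l <->
  filterlim (fun ab => RInt f (fst ab) (snd ab))
    (filter_prod (at_right 0) (Rbar_locally p_infty)) (locally l).
Proof.
  intros Hf. split; intros H P HP.
  - specialize (H P HP). unfold filtermapi in H. unfold filtermap.
    revert H. apply filter_imp. intros ab [y [H1 H2]].
    rewrite (is_RInt_unique _ _ _ _ H1). exact H2.
  - specialize (H P HP). unfold filtermapi. unfold filtermap in H.
    generalize (filter_and _ _ H half_line_ordered). apply filter_imp.
    intros ab [H1 H2]. exists (RInt f (fst ab) (snd ab)). split; [|exact H1].
    apply (RInt_correct f). apply ex_RInt_half_line; [exact Hf| |]; lra.
Qed.

Lemma is_int_ext f g (l : V) :
  (forall t, 0 < t -> f t = g t) -> is_int f l -> is_int g l.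
Proof.
  intros H. apply is_RInt_gen_ext.
  generalize half_line_ordered. apply filter_imp. intros ab Hab t Ht.
  apply H. rewrite Rmin_left in Ht; lra.
Qed.

Lemma is_int_congr f g (l l' : V) :
  (forall t, 0 < t -> f t = g t) -> l = l' -> is_int f l -> is_int g l'.
Proof. intros H <-. apply is_int_ext, H. Qed.

Lemma is_int_unique f (l : V) :
  is_int f l -> RInt_gen f (at_right 0) (Rbar_locally p_infty) = l.
Proof. apply is_RInt_gen_unique. Qed.

Lemma is_int_minus f g (lf lg : V) :
  is_int f lf -> is_int g lg -> is_int (fun t => minus (f t) (g t)) (minus lf lg).
Proof. apply (is_RInt_gen_minus f g). Qed.

Lemma is_int_scal f (k : R) (l : V) : is_int f l -> is_int (fun t => scal k (f t)) (scal k l).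
Proof. apply (is_RInt_gen_scal f k). Qed.

Lemma is_int_norm_le f (h : R -> R) (l : V) (lh : R) :
  (forall t, 0 < t -> norm (f t) <= h t) -> is_int f l -> is_int h lh -> norm l <= lh.
Proof.
  intros H. apply RInt_gen_norm.
  - generalize half_line_ordered. apply filter_imp. intros ab Hab. lra.
  - generalize half_line_ordered. apply filter_imp. intros ab Hab t Ht. apply H. lra.
Qed.

Lemma is_int_derive (F f : R -> V) (l0 l1 : V) :
  (forall t, 0 < t -> is_derive F t (f t)) ->
  (forall t, 0 < t -> continuous f t) ->
  filterlim F (at_right 0) (locally l0) ->
  filterlim F (Rbar_locally p_infty) (locally l1) ->
  is_int f (minus l1 l0).
Proof.
  intros HF Hf H0 H1. apply (is_RInt_gen_filterlim f); [exact Hf|].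
  apply filterlim_ext_loc with (fun ab => minus (F (snd ab)) (F (fst ab))).
  - generalize half_line_ordered. apply filter_imp. intros [a b] Hab. simpl in *.
    symmetry. apply is_RInt_unique. apply (is_RInt_derive F f); intros t Ht;
      rewrite Rmin_left in Ht by lra; [apply HF|apply Hf]; lra.
  - unfold minus. eapply (filterlim_comp_2 (G := locally l1) (H := locally (opp l0))).
    + eapply filterlim_comp; [apply filterlim_snd|exact H1].
    + eapply filterlim_comp; [|apply (filterlim_opp l0)].
      eapply filterlim_comp; [apply filterlim_fst|exact H0].
    + apply (filterlim_plus l1 (opp l0)).
Qed.

Lemma norm_RInt_le_Rpower f (C p a b : R) :
  p <> 0 -> 0 < a <= b -> (forall t, 0 < t -> continuous f t) ->
  (forall t, 0 < t -> norm (f t) <= C * Rpower t (p - 1)) ->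
  norm (RInt f a b) <= C * ((Rpower b p - Rpower a p) / p).
Proof.
  intros Hp Hab Hf Hb.
  apply (norm_RInt_le f (fun t => C * Rpower t (p - 1)) a b).
  - lra.
  - intros t Ht. apply Hb. lra.
  - apply (RInt_correct f). apply ex_RInt_half_line; [exact Hf| |]; lra.
  - replace (C * ((Rpower b p - Rpower a p) / p))
      with (minus (C * Rpower b p / p) (C * Rpower a p / p))
      by (unfold minus, plus, opp; simpl; field; exact Hp).
    apply (is_RInt_derive (fun t => C * Rpower t p / p)).
    + intros t Ht. rewrite Rmin_left in Ht by lra.
      replace (C * Rpower t (p - 1)) with ((C / p) * (p * Rpower t (p - 1))) by (field; exact Hp).
      apply is_derive_ext with (fun t => (C / p) * Rpower t p); [intros; simpl; field; exact Hp|].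
      apply is_derive_scal, is_derive_Rpower. lra.
    + intros t Ht. rewrite Rmin_left in Ht by lra.
      apply (continuous_scal_r C (fun t => Rpower t (p - 1))). apply continuous_Rpower. lra.
Qed.

(** Enlarging the interval from [a, b] changes the integral by at most [C0 a^p / p] on the left and
    [C1 b^(-p) / p] on the right. This gives the Cauchy property, and the same quantity survives in
    the limit as the truncation error. *)
Lemma power_dominated_integral f (C0 C1 p : R) :
  0 < p -> (forall t, 0 < t -> continuous f t) ->
  (forall t, 0 < t -> norm (f t) <= C0 * Rpower t (p - 1)) ->
  (forall t, 0 < t -> norm (f t) <= C1 * Rpower t (- p - 1)) ->
  exists l : V, is_int f l /\
    forall a b, 0 < a <= b ->
      norm (minus (RInt f a b) l) <= (C0 * Rpower a p + C1 * Rpower b (- p)) / p.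
Proof.
  intros Hp Hf Hb0 Hb1.
  assert (HC0 : 0 <= C0).
  { assert (H := Hb0 1 Rlt_0_1). assert (H' := norm_ge_0 (f 1)).
    assert (H'' := Rpower_pos 1 (p - 1)). nra. }
  assert (HC1 : 0 <= C1).
  { assert (H := Hb1 1 Rlt_0_1). assert (H' := norm_ge_0 (f 1)).
    assert (H'' := Rpower_pos 1 (- p - 1)). nra. }
  assert (Hip : 0 < / p) by (apply Rinv_0_lt_compat, Hp).
  assert (Hleft : forall a a', 0 < a <= a' -> norm (RInt f a a') <= C0 * Rpower a' p / p).
  { intros a a' Ha. eapply Rle_trans; [apply norm_RInt_le_Rpower with (C := C0) (p := p); auto; lra|].
    assert (H := Rpower_pos a p). unfold Rdiv. rewrite Rmult_assoc.
    apply Rmult_le_compat_l; [exact HC0|]. apply Rmult_le_compat_r; lra. }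
  assert (Hright : forall b b', 0 < b <= b' -> norm (RInt f b b') <= C1 * Rpower b (- p) / p).
  { intros b b' Hb. eapply Rle_trans; [apply norm_RInt_le_Rpower with (C := C1) (p := - p); auto; lra|].
    assert (H := Rpower_pos b' (- p)).
    replace ((Rpower b' (- p) - Rpower b (- p)) / - p)
      with ((Rpower b (- p) - Rpower b' (- p)) * / p) by (field; lra).
    unfold Rdiv. rewrite Rmult_assoc.
    apply Rmult_le_compat_l; [exact HC1|]. apply Rmult_le_compat_r; lra. }
  assert (Hdiff : forall a a' b b', 0 < a' <= a -> a <= b -> b <= b' ->
    norm (minus (RInt f a b) (RInt f a' b')) <= (C0 * Rpower a p + C1 * Rpower b (- p)) / p).
  { intros a a' b b' Ha Hab Hb.
    replace (minus (RInt f a b) (RInt f a' b')) with (opp (plus (RInt f a' a) (RInt f b b'))).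
    - rewrite norm_opp_complete. eapply Rle_trans; [apply (norm_triangle (RInt f a' a))|].
      replace ((C0 * Rpower a p + C1 * Rpower b (- p)) / p)
        with (C0 * Rpower a p / p + C1 * Rpower b (- p) / p) by (field; lra).
      apply Rplus_le_compat; [apply Hleft|apply Hright]; lra.
    - rewrite <- (RInt_Chasles f a' a b') by (apply ex_RInt_half_line; auto; lra).
      rewrite <- (RInt_Chasles f a b b') by (apply ex_RInt_half_line; auto; lra).
      vlinear V; ring. }
  assert (Hsmall : forall eps, 0 < eps ->
    filter_prod (at_right 0) (Rbar_locally p_infty) (fun ab =>
      (C0 * Rpower (fst ab) p + C1 * Rpower (snd ab) (- p)) / p < eps)).
  { intros eps Heps.
    (* The summand 1 keeps the denominator positive when both constants vanish. *)
    set (d := eps * p / (2 * (C0 + C1 + 1))).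
    assert (Hd : 0 < d) by (unfold d; apply Rdiv_lt_0_compat; nra).
    apply Filter_prod with (fun a => Rpower a p < d) (fun b => Rpower b (- p) < d).
    - assert (H := Rpower_filterlim_0 p Hp).
      specialize (H (fun y => y < d)). apply H.
      exists (mkposreal d Hd). intros y Hy. change (Rabs (y - 0) < d) in Hy.
      apply Rabs_def2 in Hy. lra.
    - assert (H := Rpower_filterlim_infty p Hp).
      specialize (H (fun y => y < d)). apply H.
      exists (mkposreal d Hd). intros y Hy. change (Rabs (y - 0) < d) in Hy.
      apply Rabs_def2 in Hy. lra.
    - simpl. intros a b Ha Hb. apply Rmult_lt_reg_r with p; [exact Hp|].
      unfold Rdiv at 1. rewrite Rmult_assoc, Rinv_l, Rmult_1_r by lra.
      apply Rle_lt_trans with ((C0 + C1) * d); [nra|].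
      replace (eps * p) with (2 * (C0 + C1 + 1) * d) by (unfold d; field; lra). nra. }
  destruct (proj1 (filterlim_locally_cauchy (F := filter_prod (at_right 0) (Rbar_locally p_infty))
    (fun ab => RInt f (fst ab) (snd ab)))) as [l Hl].
  { intros eps.
    set (e := eps / 2). assert (He : 0 < e) by (unfold e; destruct eps; simpl; lra).
    exists (fun ab => (C0 * Rpower (fst ab) p + C1 * Rpower (snd ab) (- p)) / p < e
        /\ 0 < fst ab <= 1 /\ 1 <= snd ab).
    split.
    - apply filter_and; [apply Hsmall, He|].
      apply half_line_exhaustion, Rlt_0_1.
    - intros [a b] [a' b']; simpl. intros [H [Ha Hb]] [H' [Ha' Hb']].
      apply (@norm_compat1 R_AbsRing V).
      (* [Hdiff] compares nested intervals only, so two arbitrary ones are compared through an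
         interval containing both. *)
      set (a'' := Rmin a a'). set (b'' := Rmax b b').
      assert (0 < a'' <= a) by (unfold a''; split; [apply Rmin_case; lra|apply Rmin_l]).
      assert (0 < a'' <= a') by (unfold a''; split; [apply Rmin_case; lra|apply Rmin_r]).
      assert (b <= b'') by apply Rmax_l. assert (b' <= b'') by apply Rmax_r.
      apply Rle_lt_trans with (1 := norm_minus_le _ (RInt f a'' b'') _).
      eapply Rle_lt_trans; [apply Rplus_le_compat; apply Hdiff; lra|]. unfold e in *. lra. }
  exists l. split; [apply is_RInt_gen_filterlim; auto|].
  (* If the error bound failed at [a, b], some larger interval would have its integral so close to
     [l] that [Hdiff] is violated. *)
  intros a b Hab. apply Rnot_lt_le. intros Hlt.
  assert (He : 0 < norm (minus (RInt f a b) l) - (C0 * Rpower a p + C1 * Rpower b (- p)) / p) by lra.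
  assert (H1 : filter_prod (at_right 0) (Rbar_locally p_infty) (fun ab =>
    ball_norm l (mkposreal _ He) (RInt f (fst ab) (snd ab)))).
  { apply Hl. apply (@locally_le_locally_norm R_AbsRing V l).
    exists (mkposreal _ He). intros y Hy. exact Hy. }
  assert (H2 := half_line_exhaustion a b (proj1 Hab)).
  destruct (filter_ex _ (filter_and _ _ H1 H2)) as [[a' b'] [H3 [H4 H5]]].
  simpl in *. unfold ball_norm in H3. simpl in H3.
  assert (H6 := Hdiff a a' b b' H4 (proj2 Hab) H5).
  assert (H7 := norm_minus_le (RInt f a b) (RInt f a' b') l).
  replace (norm (minus l (RInt f a' b'))) with (norm (minus (RInt f a' b') l)) in H7
    by (rewrite <- norm_opp_complete; f_equal; vlinear V; ring).
  change (norm (minus (RInt f a' b') l) < norm (minus (RInt f a b) l) - (C0 * Rpower a p + C1 * Rpower b (- p)) / p) in H3.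
  lra.
Qed.

End HalfLine.

(** * Boundary limits, scaling and scalar integrands *)

Section Limits.

Context {V : CompleteNormedModule R_AbsRing}.

Lemma filterlim_zero_norm_le {T : Type} (G : (T -> Prop) -> Prop) {FG : Filter G}
    (F : T -> V) (h : T -> R) :
  G (fun x => norm (F x) <= h x) -> filterlim h G (locally 0) ->
  filterlim F G (locally (zero : V)).
Proof.
  intros H Hh. apply filterlim_locally. intros eps.
  assert (H1 := proj1 (filterlim_locally h 0) Hh eps).
  generalize (filter_and _ _ H H1). apply filter_imp. intros x [H2 H3].
  apply (@norm_compat1 R_AbsRing V).
  apply Rle_lt_trans with (norm (F x)); [right; f_equal; vlinear V; ring|].
  change (Rabs (h x - 0) < eps) in H3. apply Rabs_def2 in H3.
  apply Rle_lt_trans with (1 := H2). lra.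
Qed.

Lemma half_line_at_right_0 : at_right 0 (fun t => 0 < t).
Proof. exists (mkposreal 1 Rlt_0_1). auto. Qed.

Lemma half_line_at_infty : Rbar_locally p_infty (fun t => 0 < t).
Proof. exists 0. auto. Qed.

Lemma filterlim_scal_zero {T : Type} (G : (T -> Prop) -> Prop) (C : R) (h : T -> R) :
  filterlim h G (locally 0) -> filterlim (fun x => C * h x) G (locally 0).
Proof.
  intros H. rewrite <- (Rmult_0_r C).
  apply (filterlim_comp _ _ _ h (fun y => C * y) G (locally 0)); [exact H|].
  apply (filterlim_scal_r C 0).
Qed.

Lemma filterlim_zero_Rpower_0 (F : R -> V) (C p : R) :
  0 < p -> (forall t, 0 < t -> norm (F t) <= C * Rpower t p) ->
  filterlim F (at_right 0) (locally (zero : V)).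
Proof.
  intros Hp H. apply (filterlim_zero_norm_le (at_right 0) F (fun t => C * Rpower t p)).
  - generalize half_line_at_right_0. apply filter_imp, H.
  - apply (filterlim_scal_zero _ C), Rpower_filterlim_0, Hp.
Qed.

Lemma filterlim_zero_Rpower_infty (F : R -> V) (C p : R) :
  0 < p -> (forall t, 0 < t -> norm (F t) <= C * Rpower t (- p)) ->
  filterlim F (Rbar_locally p_infty) (locally (zero : V)).
Proof.
  intros Hp H. apply (filterlim_zero_norm_le (Rbar_locally p_infty) F (fun t => C * Rpower t (- p))).
  - generalize half_line_at_infty. apply filter_imp, H.
  - apply (filterlim_scal_zero _ C), Rpower_filterlim_infty, Hp.
Qed.

Lemma is_int_scale (f : R -> V) (c : R) (l : V) :
  0 < c -> is_int f l -> is_int (fun t => scal c (f (c * t))) l.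
Proof.
  intros Hc H P HP. destruct (H P HP) as [Q S [d Hd] [N HN] HQS].
  exists (fun a => Q (c * a)) (fun b => S (c * b)).
  - assert (Hca : forall a, a < d / c -> c * a < d).
    { intros a Ha. apply Rmult_lt_reg_r with (/ c); [apply Rinv_0_lt_compat, Hc|].
      replace (c * a * / c) with a by (field; lra). exact Ha. }
    assert (He : 0 < d / c) by (apply Rdiv_lt_0_compat; [apply d|exact Hc]).
    exists (mkposreal _ He). intros a Ha Ha0.
    change (Rabs (a - 0) < d / c) in Ha. rewrite Rminus_0_r, Rabs_pos_eq in Ha by lra.
    apply Hd; [|apply Rmult_lt_0_compat; assumption]. change (Rabs (c * a - 0) < d).
    rewrite Rminus_0_r, Rabs_pos_eq by (left; apply Rmult_lt_0_compat; assumption).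
    apply Hca, Ha.
  - exists (N / c). intros b Hb. apply HN.
    apply Rmult_lt_reg_r with (/ c); [apply Rinv_0_lt_compat, Hc|].
    replace (c * b * / c) with b by (field; lra). exact Hb.
  - intros a b Ha Hb. destruct (HQS _ _ Ha Hb) as [y [Hy HPy]].
    exists y. split; [|exact HPy]. simpl in *.
    apply is_RInt_ext with (fun t => scal c (f (c * t + 0))).
    + intros. rewrite Rplus_0_r. reflexivity.
    + apply (is_RInt_comp_lin f c 0). rewrite !Rplus_0_r. exact Hy.
Qed.

Lemma Riemann_sum_scal_l (f : R -> R) (v : V) (ptd : SF_seq) :
  Riemann_sum (fun t => scal (f t) v) ptd = scal (Riemann_sum f ptd) v.
Proof.
  induction ptd as [x0 | h ptd IH] using SF_cons_ind.
  - symmetry. exact (scal_zero_l v).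
  - rewrite (Riemann_sum_cons (fun t => scal (f t) v)), (Riemann_sum_cons f), IH.
    generalize (Riemann_sum f ptd : R). intros S.
    change (plus (scal (SF_h ptd - fst h) (scal (f (snd h)) v)) (scal S v)
      = scal ((SF_h ptd - fst h) * f (snd h) + S) v).
    vlinear V; ring.
Qed.

Lemma is_RInt_scal_l (f : R -> R) (v : V) (a b l : R) :
  is_RInt f a b l -> is_RInt (fun t => scal (f t) v) a b (scal l v).
Proof.
  intros H. unfold is_RInt.
  apply filterlim_ext with (fun ptd => scal (scal (sign (b - a)) (Riemann_sum f ptd)) v).
  - intros ptd. rewrite Riemann_sum_scal_l. generalize (Riemann_sum f ptd : R). intros S.
    change (scal (sign (b - a) * S) v = scal (sign (b - a)) (scal S v)). vlinear V; ring.
  - apply (filterlim_comp _ _ _ (fun ptd => scal (sign (b - a)) (Riemann_sum f ptd))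
      (fun k => scal k v) _ (locally l)); [exact H|].
    exact (filterlim_scal_l (V := V) l v).
Qed.

Lemma is_int_scal_l (f : R -> R) (v : V) (l : R) :
  is_int f l -> is_int (fun t => scal (f t) v) (scal l v).
Proof.
  intros H Q HQ.
  generalize (H (fun y => Q (scal y v)) (filterlim_scal_l (V := V) l v Q HQ)).
  unfold filtermapi. apply filter_imp. intros ab [y [Hy1 Hy2]].
  exists (scal y v). split; [apply is_RInt_scal_l, Hy1|exact Hy2].
Qed.

End Limits.

(** * The Gamma function *)

Lemma RInt_le_is_int (f : R -> R) (a b l : R) :
  (forall t, 0 < t -> continuous f t) -> (forall t, 0 < t -> 0 <= f t) ->
  0 < a <= b -> is_int f l -> RInt f a b <= l.
Proof.
  intros Hf Hpos Hab H.
  apply (is_RInt_gen_filterlim f) in H; [|exact Hf].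
  apply Rnot_lt_le. intros Hlt.
  assert (He : 0 < RInt f a b - l) by lra.
  assert (H1 := proj1 (filterlim_locally _ l) H (mkposreal _ He)).
  assert (H2 := half_line_exhaustion a b (proj1 Hab)).
  destruct (filter_ex _ (filter_and _ _ H1 H2)) as [[a' b'] [H3 [H4 H5]]].
  simpl in H3, H4, H5. change (Rabs (RInt f a' b' - l) < RInt f a b - l) in H3.
  apply Rabs_def2 in H3.
  assert (Hex : forall x y, 0 < x -> 0 < y -> ex_RInt f x y).
  { intros x y Hx Hy. apply (ex_RInt_half_line (V := R_CompleteNormedModule)); auto. }
  assert (H6 := RInt_Chasles (V := R_CompleteNormedModule) f a' a b' (Hex a' a ltac:(lra) ltac:(lra)) (Hex a b' ltac:(lra) ltac:(lra))).
  assert (H7 := RInt_Chasles (V := R_CompleteNormedModule) f a b b' (Hex a b ltac:(lra) ltac:(lra)) (Hex b b' ltac:(lra) ltac:(lra))).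
  unfold plus in H6, H7; simpl in H6, H7.
  assert (0 <= RInt f a' a).
  { apply RInt_ge_0; [lra|apply Hex; lra|intros; apply Hpos; lra]. }
  assert (0 <= RInt f b b').
  { apply RInt_ge_0; [lra|apply Hex; lra|intros; apply Hpos; lra]. }
  lra.
Qed.

(** This is [ln y <= y] at [y = t / q], multiplied by [q]. The sharp constant would be [(q / e)^q];
    the value of the constant is irrelevant, the freedom in [q] is not. *)
Lemma exp_neg_le_Rpower (q t : R) :
  0 < q -> 0 < t -> exp (- t) <= Rpower q q * Rpower t (- q).
Proof.
  intros Hq Ht. unfold Rpower. rewrite <- exp_plus.
  assert (H : ln (t / q) <= t / q).
  { assert (0 < t / q) by (apply Rdiv_lt_0_compat; lra).
    rewrite <- (ln_exp (t / q)) at 2. left. apply ln_increasing; [lra|].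
    assert (H1 := exp_ineq1 (t / q)). lra. }
  unfold Rdiv in H at 1. rewrite ln_mult, ln_Rinv in H; try lra; [|apply Rinv_0_lt_compat; lra].
  assert (H1 : q * (ln t - ln q) <= t).
  { replace t with (q * (t / q)) at 2 by (field; lra). apply Rmult_le_compat_l; lra. }
  assert (H2 : - t <= q * ln q + - q * ln t) by lra.
  destruct H2 as [H2 | ->]; [left; apply exp_increasing, H2|right; reflexivity].
Qed.

Definition gamma_density (x t : R) : R := Rpower t (x - 1) * exp (- t).

Lemma gamma_density_pos (x t : R) : 0 < gamma_density x t.
Proof. apply Rmult_lt_0_compat; apply exp_pos. Qed.

Lemma continuous_exp_scaled (c t : R) : continuous (fun u => exp (- (c * u))) t.
Proof.
  apply (ex_derive_continuous (fun u => exp (- (c * u)))). auto_derive. exact I.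
Qed.

Lemma continuous_gamma_density (x t : R) : 0 < t -> continuous (gamma_density x) t.
Proof.
  intros Ht. apply (continuous_mult (fun t => Rpower t (x - 1)) (fun t => exp (- t))).
  - apply continuous_Rpower, Ht.
  - apply (ex_derive_continuous (fun u => exp (- u))). auto_derive. exact I.
Qed.

Lemma gamma_density_le (x q t : R) :
  0 < q -> 0 < t -> gamma_density x t <= Rpower q q * Rpower t (x - 1 - q).
Proof.
  intros Hq Ht. unfold gamma_density.
  replace (x - 1 - q) with (x - 1 + - q) by ring. rewrite Rpower_plus.
  replace (Rpower q q * (Rpower t (x - 1) * Rpower t (- q)))
    with (Rpower t (x - 1) * (Rpower q q * Rpower t (- q))) by ring.
  apply Rmult_le_compat_l; [left; apply Rpower_pos|].
  apply exp_neg_le_Rpower; assumption.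
Qed.

(** The exponential bound with [q = x - e] and [q = x + e] dominates the density by multiples of
    [t^(e-1)] and [t^(-e-1)]. The rate is what later measures, after the substitution [u = x t], how
    far a truncated integral of the kernel is from [Gamma s * t^(-s)]. *)
Lemma Gamma_integral_rate (x e : R) :
  0 < e < x ->
  is_int (gamma_density x) (Gamma x) /\
  exists K, 0 < K /\ forall a b, 0 < a <= b ->
    Rabs (RInt (gamma_density x) a b - Gamma x) <= K * (Rpower a e + Rpower b (- e)).
Proof.
  intros He.
  destruct (power_dominated_integral (V := R_CompleteNormedModule) (gamma_density x)
    (Rpower (x - e) (x - e)) (Rpower (x + e) (x + e)) e) as [l [H1 H2]].
  - lra.
  - intros t Ht. apply continuous_gamma_density, Ht.
  - intros t Ht. change (Rabs (gamma_density x t) <= Rpower (x - e) (x - e) * Rpower t (e - 1)).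
    rewrite Rabs_pos_eq by (left; apply gamma_density_pos).
    replace (e - 1) with (x - 1 - (x - e)) by ring. apply gamma_density_le; lra.
  - intros t Ht. change (Rabs (gamma_density x t) <= Rpower (x + e) (x + e) * Rpower t (- e - 1)).
    rewrite Rabs_pos_eq by (left; apply gamma_density_pos).
    replace (- e - 1) with (x - 1 - (x + e)) by ring. apply gamma_density_le; lra.
  - assert (Hl : Gamma x = l).
    { rewrite Gamma_pos by lra.
      exact (is_int_unique (V := R_CompleteNormedModule) (gamma_density x) l H1). }
    rewrite Hl. split; [exact H1|].
    set (K := (Rpower (x - e) (x - e) + Rpower (x + e) (x + e)) / e).
    assert (HK0 := Rpower_pos (x - e) (x - e)). assert (HK1 := Rpower_pos (x + e) (x + e)).
    exists K. split; [unfold K; apply Rdiv_lt_0_compat; lra|].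
    intros a b Hab. eapply Rle_trans; [exact (H2 a b Hab)|].
    assert (Ha := Rpower_pos a e). assert (Hb := Rpower_pos b (- e)).
    apply Rmult_le_reg_r with e; [lra|].
    unfold K. unfold Rdiv. rewrite Rmult_assoc, Rinv_l by lra.
    replace ((Rpower (x - e) (x - e) + Rpower (x + e) (x + e)) * / e * (Rpower a e + Rpower b (- e)) * e)
      with ((Rpower (x - e) (x - e) + Rpower (x + e) (x + e)) * (Rpower a e + Rpower b (- e)))
      by (field; lra). nra.
Qed.

Lemma Gamma_integral (x : R) : 0 < x -> is_int (gamma_density x) (Gamma x).
Proof. intros Hx. apply (Gamma_integral_rate x (x / 2)). lra. Qed.

Lemma Gamma_gt_0 (x : R) : 0 < x -> 0 < Gamma x.
Proof.
  intros Hx. apply Rlt_le_trans with (RInt (gamma_density x) 1 2).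
  - apply RInt_gt_0; [lra|intros; apply gamma_density_pos|].
    intros t Ht. apply continuous_gamma_density. lra.
  - apply RInt_le_is_int.
    + apply continuous_gamma_density.
    + intros. left. apply gamma_density_pos.
    + lra.
    + apply Gamma_integral, Hx.
Qed.

Lemma Gamma_succ (x : R) : 0 < x -> Gamma (x + 1) = x * Gamma x.
Proof.
  intros Hx.
  assert (H : is_int (fun t => minus (gamma_density (x + 1) t) (scal x (gamma_density x t)))
    (minus (Gamma (x + 1)) (scal x (Gamma x)))).
  { apply (is_RInt_gen_minus (gamma_density (x + 1)) (fun t => scal x (gamma_density x t)));
      [apply Gamma_integral; lra|].
    apply (is_RInt_gen_scal (gamma_density x)), Gamma_integral, Hx. }
  assert (Hb : forall q t, 0 < q -> 0 < t ->
    norm (- (Rpower t x * exp (- t))) <= Rpower q q * Rpower t (x - q)).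
  { intros q t Hq Ht. change (Rabs (- (Rpower t x * exp (- t))) <= Rpower q q * Rpower t (x - q)).
    rewrite Rabs_Ropp, Rabs_pos_eq by (left; apply Rmult_lt_0_compat; apply exp_pos).
    assert (H1 := gamma_density_le (x + 1) q t Hq Ht). unfold gamma_density in H1.
    replace (x + 1 - 1) with x in H1 by ring. exact H1. }
  assert (H' : is_int (fun t => minus (gamma_density (x + 1) t) (scal x (gamma_density x t)))
    (minus 0 0)).
  (* Integration by parts as an exact derivative: the antiderivative vanishes at both ends. *)
  { apply (is_int_derive (V := R_CompleteNormedModule) (fun t => - (Rpower t x * exp (- t)))).
    - intros t Ht. unfold gamma_density.
      replace (x + 1 - 1) with x by ring.
      evar_last.
      { apply (is_derive_opp (fun t => Rpower t x * exp (- t))).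
        apply (is_derive_mult (fun t => Rpower t x) (fun t => exp (- t))).
        - apply is_derive_Rpower, Ht.
        - auto_derive; [exact I|reflexivity].
        - intros; apply Rmult_comm. }
      unfold minus, plus, opp, scal, mult; simpl. unfold mult; simpl. ring.
    - intros t Ht. apply (continuous_minus (gamma_density (x + 1)) (fun t => scal x (gamma_density x t))).
      + apply continuous_gamma_density, Ht.
      + apply (continuous_scal_r x (gamma_density x)), continuous_gamma_density, Ht.
    - apply (filterlim_zero_Rpower_0 (V := R_CompleteNormedModule) _ (Rpower (x / 2) (x / 2)) (x / 2)); [lra|].
      intros t Ht. replace (x / 2) with (x - x / 2) at 3 by field. apply Hb; lra.
    - apply (filterlim_zero_Rpower_infty (V := R_CompleteNormedModule) _ (Rpower (x + 1) (x + 1)) 1); [lra|].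
      intros t Ht. replace (- (1)) with (x - (x + 1)) by ring. apply Hb; lra. }
  apply (is_int_unique (V := R_CompleteNormedModule)) in H.
  apply (is_int_unique (V := R_CompleteNormedModule)) in H'.
  rewrite H in H'. unfold minus, plus, opp, scal, mult in H'; simpl in H'. unfold mult in H'; simpl in H'. lra.
Qed.

Lemma Gamma_1 : Gamma 1 = 1.
Proof.
  assert (H : is_int (gamma_density 1) (minus 0 (-1))).
  { apply (is_int_derive (V := R_CompleteNormedModule) (fun t => - exp (- t))).
    - intros t Ht. unfold gamma_density. replace (1 - 1) with 0 by ring.
      rewrite Rpower_O by exact Ht. auto_derive; [exact I|ring].
    - intros t Ht. apply continuous_gamma_density, Ht.
    - replace (-1) with (- exp (- 0)) by (rewrite Ropp_0, exp_0; ring).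
      apply (filterlim_filter_le_1 (G := at_right 0) (F := locally 0)).
      + apply filter_le_within.
      + apply (ex_derive_continuous (fun u => - exp (- u))). auto_derive. exact I.
    - apply (filterlim_zero_Rpower_infty (V := R_CompleteNormedModule) _ (Rpower 1 1) 1); [lra|].
      intros t Ht. change (Rabs (- exp (- t)) <= Rpower 1 1 * Rpower t (- (1))).
      rewrite Rabs_Ropp, Rabs_pos_eq by (left; apply exp_pos). apply exp_neg_le_Rpower; lra. }
  apply (is_int_unique (V := R_CompleteNormedModule)) in H.
  assert (H1 := is_int_unique (V := R_CompleteNormedModule) _ _ (Gamma_integral 1 Rlt_0_1)).
  rewrite H in H1. rewrite <- H1. unfold minus, plus, opp; simpl. ring.
Qed.

Lemma Laplace_Rpower (a c : R) :
  -1 < a -> 0 < c ->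
  is_int (fun t => Rpower t a * exp (- (c * t))) (Gamma (a + 1) * Rpower c (- a - 1)).
Proof.
  intros Ha Hc.
  assert (H := is_int_scale (V := R_CompleteNormedModule) _ c _ Hc (Gamma_integral (a + 1) ltac:(lra))).
  apply (is_RInt_gen_scal _ (Rpower c (- a - 1))) in H.
  rewrite Rmult_comm. revert H. apply (is_int_ext (V := R_CompleteNormedModule)).
  intros t Ht. unfold scal; simpl. unfold mult; simpl. unfold gamma_density.
  replace (a + 1 - 1) with a by ring. rewrite <- Rpower_mult_distr by assumption.
  replace (- a - 1) with (- (a + 1)) by ring. rewrite Rpower_Ropp, Rpower_add_1 by exact Hc.
  field. split; [|lra]. apply Rgt_not_eq, Rpower_pos.
Qed.

(** The concave function [t^s] lies below its tangent at [t = x]. The point [x] is chosen so that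
    integration against the gamma density of parameter [x] loses little. *)
Lemma Rpower_le_tangent (x t s : R) :
  0 < x -> 0 < t -> 0 <= s <= 1 ->
  Rpower t s <= Rpower x s * (s * (t / x) + (1 - s)).
Proof.
  intros Hx Ht Hs.
  replace (Rpower t s) with (Rpower x s * Rpower (t / x) s).
  2:{ rewrite Rpower_mult_distr by (try apply Rdiv_lt_0_compat; assumption). f_equal. field. lra. }
  apply Rmult_le_compat_l; [left; apply Rpower_pos|].
  assert (Hy : 0 < t / x) by (apply Rdiv_lt_0_compat; assumption).
  revert Hy. generalize (t / x). intros y Hy. unfold Rpower.
  set (u := ln y). replace y with (exp u) by (apply exp_ln, Hy).
  (* Convexity: exp lies above its tangent line at [s * u]. *)
  assert (H1 := exp_ineq1_le (u - s * u)). assert (H2 := exp_ineq1_le (- (s * u))).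
  assert (Hm := exp_pos (s * u)).
  assert (H3 : exp u = exp (s * u) * exp (u - s * u)) by (rewrite <- exp_plus; f_equal; ring).
  assert (H4 : 1 = exp (s * u) * exp (- (s * u))).
  { rewrite <- exp_plus, Rplus_opp_r, exp_0. reflexivity. }
  apply (Rmult_le_compat_l s) in H1; [|lra]. apply (Rmult_le_compat_l (1 - s)) in H2; [|lra].
  rewrite H3.
  replace (1 - s) with ((1 - s) * (exp (s * u) * exp (- (s * u)))) by (rewrite <- H4; ring).
  rewrite <- (Rmult_1_r (exp (s * u))) at 1.
  replace (s * (exp (s * u) * exp (u - s * u)) + (1 - s) * (exp (s * u) * exp (- (s * u))))
    with (exp (s * u) * (s * exp (u - s * u) + (1 - s) * exp (- (s * u)))) by ring.
  apply Rmult_le_compat_l; lra.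
Qed.

(** Half of Wendel's inequality. Integrating the tangent bound produces [s / x * Gamma (x + 1) + (1
    - s) * Gamma x], which collapses to [Gamma x]. *)
Lemma Gamma_add_le (x s : R) :
  0 < x -> 0 <= s <= 1 -> Gamma (x + s) <= Gamma x * Rpower x s.
Proof.
  intros Hx Hs.
  assert (H : is_int (fun t => Rpower x s * (s / x * gamma_density (x + 1) t + (1 - s) * gamma_density x t))
    (Rpower x s * (s / x * Gamma (x + 1) + (1 - s) * Gamma x))).
  { apply (is_RInt_gen_scal (V := R_NormedModule) (fun t => s / x * gamma_density (x + 1) t + (1 - s) * gamma_density x t)).
    apply (is_RInt_gen_plus (V := R_NormedModule) (fun t => s / x * gamma_density (x + 1) t) (fun t => (1 - s) * gamma_density x t)).
    - apply (is_RInt_gen_scal (V := R_NormedModule) (gamma_density (x + 1))), Gamma_integral. lra.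
    - apply (is_RInt_gen_scal (V := R_NormedModule) (gamma_density x)), Gamma_integral, Hx. }
  replace (Rpower x s * (s / x * Gamma (x + 1) + (1 - s) * Gamma x))
    with (Gamma x * Rpower x s) in H by (rewrite Gamma_succ by exact Hx; field; lra).
  rewrite <- (Rabs_pos_eq (Gamma (x + s))) by (left; apply Gamma_gt_0; lra).
  refine (is_int_norm_le (V := R_CompleteNormedModule) (gamma_density (x + s)) _ _ _ _ (Gamma_integral (x + s) ltac:(lra)) H).
  intros t Ht. change (Rabs (gamma_density (x + s) t) <= Rpower x s * (s / x * gamma_density (x + 1) t + (1 - s) * gamma_density x t)).
  rewrite Rabs_pos_eq by (left; apply gamma_density_pos). unfold gamma_density.
  replace (x + s - 1) with ((x - 1) + s) by ring. replace (x + 1 - 1) with ((x - 1) + 1) by ring.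
  rewrite Rpower_add_1 by exact Ht. rewrite Rpower_plus.
  assert (H1 := Rpower_le_tangent x t s Hx Ht Hs).
  assert (H2 : 0 < Rpower t (x - 1) * exp (- t)) by (apply Rmult_lt_0_compat; apply exp_pos).
  apply (Rmult_le_compat_l _ _ _ (Rlt_le _ _ H2)) in H1.
  eapply Rle_trans; [|eapply Rle_trans; [exact H1|]]; right; field; lra.
Qed.

(** * Euler's reflection formula *)

Definition cos_power (a : R) (n : nat) (x : R) : R := cos (a * x) * cos x ^ n.

(** The integrals of the elementary proof of Euler's sine product: the quotient of the moments for
    [a = 2 s] and [a = 0] is [sin (PI s) / (PI s)] at [n = 0] and tends to 1 as [n] grows. *)
Definition cos_moment (a : R) (n : nat) : R := RInt (cos_power a n) 0 (PI / 2).

Lemma continuous_cos_power (a : R) (n : nat) (x : R) : continuous (cos_power a n) x.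
Proof.
  apply (ex_derive_continuous (cos_power a n)). unfold cos_power. auto_derive. exact I.
Qed.

Lemma ex_RInt_cos_power (a : R) (n : nat) (x y : R) : ex_RInt (cos_power a n) x y.
Proof.
  apply (ex_RInt_continuous (V := R_CompleteNormedModule)).
  intros. apply continuous_cos_power.
Qed.

Lemma cos_moment_recurrence (a : R) (n : nat) :
  ((INR n + 2) ^ 2 - a ^ 2) * cos_moment a (n + 2)
    = (INR n + 2) * (INR n + 1) * cos_moment a n.
Proof.
  set (m := INR n + 2).
  (* [F] collects the boundary terms of two integrations by parts. It vanishes at 0 through the
     sines and at [PI / 2] through the positive powers of the cosine. *)
  set (F := fun x => m * (cos (a * x) * cos x ^ (n + 1) * sin x)
                       - a * (sin (a * x) * cos x ^ (n + 2))).
  set (f := fun x => (m ^ 2 - a ^ 2) * cos_power a (n + 2) x - m * (m - 1) * cos_power a n x).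
  assert (H1 : is_RInt f 0 (PI / 2) (F (PI / 2) - F 0)).
  { apply (is_RInt_derive (V := R_CompleteNormedModule) F f).
    - intros x _. unfold F, f, cos_power. auto_derive; [exact I|].
      replace (Nat.pred (n + 1)) with n by lia. replace (Nat.pred (n + 2)) with (n + 1)%nat by lia.
      rewrite !plus_INR, !pow_add. simpl (INR 1). simpl (INR 2). unfold m.
      assert (Hs : sin x * sin x = 1 - cos x * cos x).
      { assert (H := sin2_cos2 x). unfold Rsqr in H. lra. }
      generalize dependent (sin x). generalize (cos x). intros c s Hs.
      generalize (cos (a * x)) (sin (a * x)) (c ^ n) (INR n). intros.
      simpl. ring_simplify. replace (s ^ 2) with (1 - c * c) by (rewrite <- Hs; ring). ring.
    - intros x _. apply (ex_derive_continuous f). unfold f, cos_power. auto_derive. repeat split. }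
  assert (H2 : is_RInt f 0 (PI / 2) ((m ^ 2 - a ^ 2) * cos_moment a (n + 2) - m * (m - 1) * cos_moment a n)).
  { apply (is_RInt_minus (V := R_NormedModule) (fun x => (m ^ 2 - a ^ 2) * cos_power a (n + 2) x) (fun x => m * (m - 1) * cos_power a n x)).
    - apply (is_RInt_scal (V := R_NormedModule)), (RInt_correct (V := R_CompleteNormedModule)), ex_RInt_cos_power.
    - apply (is_RInt_scal (V := R_NormedModule)), (RInt_correct (V := R_CompleteNormedModule)), ex_RInt_cos_power. }
  assert (H3 : F (PI / 2) - F 0 = 0).
  { unfold F. rewrite cos_PI2, Rmult_0_r, sin_0, !pow_add. simpl. ring. }
  rewrite H3 in H1.
  apply (is_RInt_unique (V := R_CompleteNormedModule)) in H1, H2. rewrite H1 in H2.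
  replace (INR n + 1) with (m - 1) by (unfold m; ring). lra.
Qed.

Lemma cos_moment_0_pos (n : nat) : 0 < cos_moment 0 n.
Proof.
  apply RInt_gt_0.
  - assert (H := PI_RGT_0). lra.
  - intros x Hx. unfold cos_power. rewrite Rmult_0_l, cos_0, Rmult_1_l.
    apply pow_lt, cos_gt_0; lra.
  - intros x _. apply continuous_cos_power.
Qed.

(** For large [n] the weight [cos x ^ n] concentrates at 0, where [cos (2 s x)] is close to 1. *)
Lemma cos_moment_ratio_bounds (s : R) (n : nat) :
  0 <= s <= 1 ->
  (1 - 2 / (INR n + 2)) * cos_moment 0 n <= cos_moment (2 * s) n <= cos_moment 0 n.
Proof.
  intros Hs.
  assert (HPI := PI_RGT_0).
  assert (Hc : forall x, 0 < x < PI / 2 -> 0 <= cos x ^ n).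
  { intros x Hx. apply pow_le, cos_ge_0; lra. }
  assert (Hn := pos_INR n).
  split.
  (* The recurrence at [a = 0] identifies the lower bound with the integral of
     [(2 cos^2 x - 1) cos^n x], which is then compared pointwise. *)
  - replace ((1 - 2 / (INR n + 2)) * cos_moment 0 n)
      with (- cos_moment 0 n + 2 * cos_moment 0 (n + 2)).
    2:{ assert (H := cos_moment_recurrence 0 n).
        replace (cos_moment 0 (n + 2)) with ((INR n + 1) / (INR n + 2) * cos_moment 0 n).
        - field. lra.
        - apply Rmult_eq_reg_l with ((INR n + 2) ^ 2 - 0 ^ 2); [rewrite H; field; lra|]. nra. }
    assert (HI : is_RInt (fun x => (-1) * cos_power 0 n x + 2 * cos_power 0 (n + 2) x) 0 (PI / 2)
      (- cos_moment 0 n + 2 * cos_moment 0 (n + 2))).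
    { replace (- cos_moment 0 n) with ((-1) * cos_moment 0 n) by ring.
      apply (is_RInt_plus (V := R_NormedModule) (fun x => (-1) * cos_power 0 n x) (fun x => 2 * cos_power 0 (n + 2) x)).
      - apply (is_RInt_scal (V := R_NormedModule)), (RInt_correct (V := R_CompleteNormedModule)), ex_RInt_cos_power.
      - apply (is_RInt_scal (V := R_NormedModule)), (RInt_correct (V := R_CompleteNormedModule)), ex_RInt_cos_power. }
    rewrite <- (is_RInt_unique _ _ _ _ HI). apply RInt_le.
    + lra.
    + eexists; exact HI.
    + apply ex_RInt_cos_power.
    + intros x Hx. unfold cos_power. rewrite Rmult_0_l, cos_0, pow_add.
      (* [1 - cos (2 s x) = 2 sin^2 (s x) <= 2 sin^2 x] *)
      assert (H1 : sin (s * x) <= sin x) by (apply sin_incr_1; nra).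
      assert (H2 : 0 <= sin (s * x)) by (apply sin_ge_0; nra).
      replace (2 * s * x) with (2 * (s * x)) by ring. rewrite cos_2a_sin.
      assert (H3 := sin2_cos2 x). unfold Rsqr in H3.
      assert (H4 := Hc x Hx).
      assert (H5 : sin (s * x) * sin (s * x) <= sin x * sin x) by nra.
      apply Rle_trans with (cos x ^ n * (1 - 2 * (sin x * sin x))); [|nra].
      right. replace (sin x * sin x) with (1 - cos x * cos x) by lra. simpl. ring.
  - apply RInt_le; [lra|apply ex_RInt_cos_power|apply ex_RInt_cos_power|].
    intros x Hx. unfold cos_power. rewrite Rmult_0_l, cos_0.
    apply Rmult_le_compat_r; [apply Hc, Hx|]. apply COS_bound.
Qed.

Lemma cos_moment_at_0 (s : R) : 0 < s -> cos_moment (2 * s) 0 = sin (PI * s) / (2 * s).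
Proof.
  intros Hs. apply is_RInt_unique.
  replace (sin (PI * s) / (2 * s)) with (minus (sin (2 * s * (PI / 2)) / (2 * s)) (sin (2 * s * 0) / (2 * s))).
  - apply (is_RInt_derive (fun x => sin (2 * s * x) / (2 * s))).
    + intros x _. unfold cos_power. auto_derive; [lra|]. simpl. field. lra.
    + intros x _. apply continuous_cos_power.
  - rewrite Rmult_0_r, sin_0. unfold minus, plus, opp; simpl.
    replace (2 * s * (PI / 2)) with (PI * s) by field. field. lra.
Qed.

Lemma cos_moment_0_0 : cos_moment 0 0 = PI / 2.
Proof.
  apply is_RInt_unique. replace (PI / 2) with (scal (PI / 2 - 0) 1) at 2.
  - apply (is_RInt_ext (fun _ => 1)).
    + intros. unfold cos_power. rewrite Rmult_0_l, cos_0. simpl. ring.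
    + apply (is_RInt_const (V := R_NormedModule)).
  - unfold scal; simpl; unfold mult; simpl. ring.
Qed.

(* Euler's sine product against Gauss's product for Gamma: multiplying by
   [(1 - s^2 / (n + 1)^2)] advances the Gamma ratio and sets back the cosine ratio. *)
Definition reflection_ratio (s : R) (n : nat) : R :=
  Gamma (INR n + 1 + s) * Gamma (INR n + 1 - s) / (Gamma (INR n + 1)) ^ 2
  * (cos_moment (2 * s) (2 * n) / cos_moment 0 (2 * n)).

Lemma reflection_ratio_const (s : R) (n : nat) :
  0 < s < 1 -> reflection_ratio s (S n) = reflection_ratio s n.
Proof.
  intros Hs. unfold reflection_ratio. rewrite S_INR.
  assert (Hn := pos_INR n). set (x := INR n) in *.
  replace (x + 1 + 1 + s) with (x + 1 + s + 1) by ring. replace (x + 1 + 1 - s) with (x + 1 - s + 1) by ring.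
  rewrite !Gamma_succ by lra.
  replace (2 * S n)%nat with (2 * n + 2)%nat by lia.
  assert (H2n : INR (2 * n) = 2 * x) by (rewrite mult_INR; reflexivity).
  assert (H1 := cos_moment_recurrence (2 * s) (2 * n)). assert (H0 := cos_moment_recurrence 0 (2 * n)).
  rewrite H2n in H0, H1.
  assert (P0 := cos_moment_0_pos (2 * n)). assert (P1 := cos_moment_0_pos (2 * n + 2)).
  assert (PG := Gamma_gt_0 (x + 1) ltac:(lra)).
  assert (E0 : cos_moment 0 (2 * n) = (2 * x + 2) / (2 * x + 1) * cos_moment 0 (2 * n + 2)).
  { apply Rmult_eq_reg_l with ((2 * x + 2) * (2 * x + 1)); [|nra]. rewrite <- H0. field. lra. }
  assert (E1 : cos_moment (2 * s) (2 * n) = ((2 * x + 2) ^ 2 - (2 * s) ^ 2) / ((2 * x + 2) * (2 * x + 1)) * cos_moment (2 * s) (2 * n + 2)).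
  { apply Rmult_eq_reg_l with ((2 * x + 2) * (2 * x + 1)); [|nra]. rewrite <- H1. field. lra. }
  rewrite E0, E1. field. repeat split; try lra.
Qed.

(** Each side multiplies two instances of [Gamma_add_le] with complementary steps [s] and [1 - s].
    Their exponents sum to 1, so [Hmix] bounds the product of powers by [x + 1]. *)
Lemma Gamma_product_bounds (x s : R) :
  0 < x -> 0 < s < 1 ->
  x / (x + 1) * Gamma (x + 1) ^ 2 <= Gamma (x + 1 + s) * Gamma (x + 1 - s)
    <= (x + 1) / x * Gamma (x + 1) ^ 2.
Proof.
  intros Hx Hs.
  assert (Hmix : forall u v r, 0 < u <= x + 1 -> 0 < v <= x + 1 -> 0 <= r <= 1 ->
    Rpower u r * Rpower v (1 - r) <= x + 1).
  { intros u v r Hu Hv Hr.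
    apply Rle_trans with (Rpower (x + 1) r * Rpower (x + 1) (1 - r)).
    - apply Rmult_le_compat; try (left; apply Rpower_pos); apply Rle_Rpower_l; lra.
    - rewrite <- Rpower_plus. replace (r + (1 - r)) with 1 by ring. rewrite Rpower_1; lra. }
  assert (G0 := Gamma_gt_0 x Hx). assert (G1 := Gamma_gt_0 (x + 1) ltac:(lra)).
  assert (G2 := Gamma_gt_0 (x + 1 + s) ltac:(lra)). assert (G3 := Gamma_gt_0 (x + 1 - s) ltac:(lra)).
  split.
  - assert (L1 := Gamma_add_le (x + s) (1 - s) ltac:(lra) ltac:(lra)).
    assert (L2 := Gamma_add_le (x + 1 - s) s ltac:(lra) ltac:(lra)).
    replace (x + s + (1 - s)) with (x + 1) in L1 by ring.
    replace (x + 1 - s + s) with (x + 1) in L2 by ring.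
    assert (E : Gamma (x + 1 + s) = (x + s) * Gamma (x + s)).
    { replace (x + 1 + s) with (x + s + 1) by ring. apply Gamma_succ. lra. }
    assert (G4 := Gamma_gt_0 (x + s) ltac:(lra)).
    assert (M := Hmix (x + 1 - s) (x + s) s ltac:(lra) ltac:(lra) ltac:(lra)).
    assert (H : Gamma (x + 1) * Gamma (x + 1) <= Gamma (x + s) * Gamma (x + 1 - s) * (x + 1)).
    { eapply Rle_trans; [apply Rmult_le_compat; [lra|lra|exact L1|exact L2]|].
      replace (Gamma (x + s) * Rpower (x + s) (1 - s) * (Gamma (x + 1 - s) * Rpower (x + 1 - s) s))
        with (Gamma (x + s) * Gamma (x + 1 - s) * (Rpower (x + 1 - s) s * Rpower (x + s) (1 - s))) by ring.
      apply Rmult_le_compat_l; [|exact M]. apply Rmult_le_pos; lra. }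
    rewrite E. apply Rmult_le_reg_l with ((x + 1) / x); [apply Rdiv_lt_0_compat; lra|].
    replace ((x + 1) / x * (x / (x + 1) * Gamma (x + 1) ^ 2)) with (Gamma (x + 1) * Gamma (x + 1)) by (field; lra).
    apply Rle_trans with (1 := H).
    apply Rmult_le_reg_l with x; [exact Hx|].
    replace (x * ((x + 1) / x * ((x + s) * Gamma (x + s) * Gamma (x + 1 - s))))
      with ((x + s) * (Gamma (x + s) * Gamma (x + 1 - s) * (x + 1))) by (field; lra).
    apply Rmult_le_compat_r; [|lra]. repeat apply Rmult_le_pos; lra.
  - assert (L1 := Gamma_add_le (x + 1) s ltac:(lra) ltac:(lra)).
    assert (L2 := Gamma_add_le x (1 - s) ltac:(lra) ltac:(lra)).
    replace (x + (1 - s)) with (x + 1 - s) in L2 by ring.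
    assert (M := Hmix (x + 1) x s ltac:(lra) ltac:(lra) ltac:(lra)).
    eapply Rle_trans; [apply Rmult_le_compat; [lra|lra|exact L1|exact L2]|].
    replace (Gamma (x + 1) * Rpower (x + 1) s * (Gamma x * Rpower x (1 - s)))
      with (Gamma (x + 1) * Gamma x * (Rpower (x + 1) s * Rpower x (1 - s))) by ring.
    replace ((x + 1) / x * Gamma (x + 1) ^ 2) with (Gamma (x + 1) * Gamma x * (x + 1))
      by (rewrite Gamma_succ by exact Hx; field; lra).
    apply Rmult_le_compat_l; [|exact M]. apply Rmult_le_pos; lra.
Qed.

Lemma is_lim_seq_inv_INR_shift (c : R) : 0 < c -> is_lim_seq (fun n => / (INR n + c)) 0.
Proof.
  intros Hc. replace (Finite 0) with (Rbar_inv p_infty) by reflexivity.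
  apply is_lim_seq_inv; [|discriminate].
  apply is_lim_seq_le_p_loc with INR; [|apply is_lim_seq_INR].
  exists O. intros. lra.
Qed.

Lemma reflection_ratio_limit (s : R) :
  0 < s < 1 -> is_lim_seq (reflection_ratio s) 1.
Proof.
  (* The shift makes the parameter [INR n + 1] positive, as [Gamma_product_bounds] requires. *)
  intros Hs. apply is_lim_seq_incr_1.
  assert (L1 := is_lim_seq_inv_INR_shift 1 ltac:(lra)).
  assert (L2 := is_lim_seq_inv_INR_shift 2 ltac:(lra)).
  apply (is_lim_seq_le_le
    (fun n => (1 - / (INR n + 2)) * (1 - / (INR n + 2))) _ (fun n => 1 + / (INR n + 1))).
  - intros n. unfold reflection_ratio. rewrite S_INR. assert (Hn := pos_INR n).
    assert (B := Gamma_product_bounds (INR n + 1) s ltac:(lra) Hs).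
    assert (C := cos_moment_ratio_bounds s (2 * S n) ltac:(lra)).
    assert (P0 := cos_moment_0_pos (2 * S n)).
    rewrite mult_INR, (S_INR n) in C. simpl (INR 2) in C.
    set (x := INR n) in *. set (w := cos_moment (2 * s) (2 * S n)) in *.
    set (w0 := cos_moment 0 (2 * S n)) in *.
    assert (PG := Gamma_gt_0 (x + 1 + 1) ltac:(lra)). set (G := Gamma (x + 1 + 1)) in *.
    assert (Hi2 : 0 < / (x + 2) < 1).
    { split; [apply Rinv_0_lt_compat; lra|]. rewrite <- Rinv_1. apply Rinv_lt_contravar; lra. }
    assert (Hi1 : 0 < / (x + 1)) by (apply Rinv_0_lt_compat; lra).
    set (r := Gamma (x + 1 + 1 + s) * Gamma (x + 1 + 1 - s) / G ^ 2).
    assert (Hr : 1 - / (x + 2) <= r <= 1 + / (x + 1)).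
    { assert (PG2 : 0 < G ^ 2) by (apply pow_lt, PG).
      unfold r; split; apply Rmult_le_reg_r with (G ^ 2); try exact PG2;
        unfold Rdiv; rewrite (Rmult_assoc _ (/ G ^ 2)), Rinv_l, Rmult_1_r by lra.
      - eapply Rle_trans; [|apply B]. right. field. lra.
      - eapply Rle_trans; [apply B|]. right. field. lra. }
    assert (Hw : 1 - / (x + 2) <= w / w0 <= 1).
    { split; apply Rmult_le_reg_r with w0; try exact P0;
        unfold Rdiv; rewrite Rmult_assoc, Rinv_l, Rmult_1_r by lra; [|lra].
      eapply Rle_trans; [|apply C]. right. field. lra. }
    split.
    + apply Rmult_le_compat; lra.
    + apply Rle_trans with ((1 + / (x + 1)) * 1); [apply Rmult_le_compat; lra|lra].
  - replace (Finite 1) with (Rbar_mult (Finite (1 - 0)) (Finite (1 - 0))) by (simpl; f_equal; ring).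
    apply is_lim_seq_mult'; apply is_lim_seq_minus'; (apply is_lim_seq_const || exact L2).
  - replace (Finite 1) with (Finite (1 + 0)) by (f_equal; ring).
    apply is_lim_seq_plus'; [apply is_lim_seq_const|exact L1].
Qed.

(** A constant sequence with limit 1 equals 1 already at index 0, where the cosine quotient is
    [sin (PI s) / (PI s)]. *)
Lemma Gamma_reflection (s : R) :
  0 < s < 1 -> Gamma (1 + s) * Gamma (1 - s) = PI * s / sin (PI * s).
Proof.
  intros Hs.
  assert (H : reflection_ratio s 0 = 1).
  { apply (f_equal real (x := Finite _) (y := Finite _)).
    transitivity (Lim_seq (reflection_ratio s)).
    - symmetry. apply is_lim_seq_unique.
      apply is_lim_seq_ext with (fun _ => reflection_ratio s 0); [|apply is_lim_seq_const].
      induction n as [|n IH]; [reflexivity|]. rewrite reflection_ratio_const; assumption.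
    - apply is_lim_seq_unique, reflection_ratio_limit, Hs. }
  unfold reflection_ratio in H. simpl (INR 0) in H. simpl (2 * 0)%nat in H.
  rewrite Rplus_0_l, Gamma_1, cos_moment_at_0, cos_moment_0_0 in H by lra.
  assert (HPI := PI_RGT_0).
  assert (Hsin : 0 < sin (PI * s)) by (apply sin_gt_0; nra).
  apply Rmult_eq_reg_r with (sin (PI * s) / (2 * s) / (PI / 2)).
  - transitivity 1; [etransitivity; [|exact H]; field; lra|field; lra].
  - apply Rgt_not_eq. repeat apply Rdiv_lt_0_compat; lra.
Qed.

(** * Uniqueness of Laplace transforms *)

(** This closes the uniqueness proof: mass near the peak would decay no slower than [r'^n], yet stay
    below a multiple of [r^n]. *)
Lemma pow_ratio_unbounded (a D r r' : R) :
  0 < a -> 0 < r < r' -> ~ (forall n : nat, a * r' ^ n <= D * r ^ n).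
Proof.
  intros Ha Hr H.
  assert (HD : 0 < D).
  { assert (H0 := H O). simpl in H0. lra. }
  assert (Hx : Rabs (r / r') < 1).
  { rewrite Rabs_pos_eq by (left; apply Rdiv_lt_0_compat; lra).
    apply Rmult_lt_reg_r with r'; [lra|]. unfold Rdiv. rewrite Rmult_assoc, Rinv_l; lra. }
  destruct (pow_lt_1_zero _ Hx (a / D) (Rdiv_lt_0_compat _ _ Ha HD)) as [n Hn].
  specialize (Hn n (Nat.le_refl n)). specialize (H n).
  rewrite Rabs_pos_eq in Hn by (apply pow_le; left; apply Rdiv_lt_0_compat; lra).
  unfold Rdiv in Hn. rewrite Rpow_mult_distr, pow_inv in Hn.
  assert (Hp : 0 < r' ^ n) by (apply pow_lt; lra).
  apply (Rmult_lt_compat_r (D * r' ^ n)) in Hn; [|apply Rmult_lt_0_compat; lra].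
  replace (r ^ n * / r' ^ n * (D * r' ^ n)) with (D * r ^ n) in Hn by (field; lra).
  replace (a * / D * (D * r' ^ n)) with (a * r' ^ n) in Hn by (field; lra).
  lra.
Qed.

Section LaplaceUniqueness.

Context {V : CompleteNormedModule R_AbsRing}.

Lemma power_dominated_norm_le (f : R -> V) (C0 C1 p : R) :
  0 < p -> (forall t, 0 < t -> continuous f t) ->
  (forall t, 0 < t -> norm (f t) <= C0 * Rpower t (p - 1)) ->
  (forall t, 0 < t -> norm (f t) <= C1 * Rpower t (- p - 1)) ->
  exists l : V, is_int f l /\ norm l <= (C0 + C1) / p.
Proof.
  intros Hp Hf H0 H1. destruct (power_dominated_integral f C0 C1 p Hp Hf H0 H1) as [l [Hl H]].
  (* On the degenerate interval from 1 to 1 the truncated integral is zero, so the truncation error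
     bounds [l] itself. *)
  exists l. split; [exact Hl|]. specialize (H 1 1 ltac:(lra)).
  rewrite RInt_point in H. rewrite <- (norm_opp_complete l).
  replace (opp l) with (minus zero l) by (vlinear V; ring).
  unfold Rpower in H. rewrite ln_1, !Rmult_0_r, exp_0, !Rmult_1_r in H. exact H.
Qed.

Lemma continuous_norm (f : R -> V) (t : R) : continuous f t -> continuous (fun t => norm (f t)) t.
Proof.
  intros H. apply (continuous_comp f norm); [exact H|]. apply (@filterlim_norm R_AbsRing V).
Qed.

Definition peak (c t : R) : R := 1 - (exp (- t) - c) ^ 2.

Lemma continuous_peak (c t : R) : continuous (peak c) t.
Proof. apply (ex_derive_continuous (peak c)). unfold peak. auto_derive. exact I. Qed.

Lemma peak_bounds (c t : R) : 0 < c < 1 -> 0 < t -> 0 <= peak c t <= 1.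
Proof.
  intros Hc Ht. unfold peak. assert (H := exp_pos (- t)).
  assert (H1 : exp (- t) < 1) by (rewrite <- exp_0; apply exp_increasing; lra).
  assert (H2 : 0 <= (1 - (exp (- t) - c)) * (1 + (exp (- t) - c))) by (apply Rmult_le_pos; lra).
  assert (H3 := pow2_ge_0 (exp (- t) - c)).
  split; lra.
Qed.

(** As [peak c t = (1 - c^2) + 2 c exp (- t) - exp (- 2 t)], one more factor raises the index [k] by
    0, 1 or 2. The induction on [n] therefore has to treat all [k] at once. *)
Lemma is_int_peak_pow_zero (v : R -> V) (c : R) :
  (forall k : nat, is_int (fun t => scal (exp (- (INR k * t))) (v t)) zero) ->
  forall n k : nat, is_int (fun t => scal (exp (- (INR k * t)) * peak c t ^ n) (v t)) zero.
Proof.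
  intros H n. induction n as [|n IH]; intros k.
  - generalize (H k). apply is_int_ext. intros t _. simpl.
    rewrite Rmult_1_r. reflexivity.
  - set (w := fun (k : nat) t => scal (exp (- (INR k * t)) * peak c t ^ n) (v t)).
    assert (H1 : is_int (fun t => plus (plus (scal (1 - c ^ 2) (w k t)) (scal (2 * c) (w (k + 1)%nat t)))
      (scal (-1) (w (k + 2)%nat t))) (plus (plus (scal (1 - c ^ 2) zero) (scal (2 * c) zero)) (scal (-1) zero))).
    { apply (is_RInt_gen_plus (fun t => plus (scal (1 - c ^ 2) (w k t)) (scal (2 * c) (w (k + 1)%nat t)))
        (fun t => scal (-1) (w (k + 2)%nat t)));
        [apply (is_RInt_gen_plus (fun t => scal (1 - c ^ 2) (w k t)) (fun t => scal (2 * c) (w (k + 1)%nat t)))|].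
      - apply (is_RInt_gen_scal (w k)), IH.
      - apply (is_RInt_gen_scal (w (k + 1)%nat)), IH.
      - apply (is_RInt_gen_scal (w (k + 2)%nat)), IH. }
    revert H1. apply is_int_congr; [|vlinear V; ring].
    intros t _. unfold w. vlinear V.
    rewrite !plus_INR. simpl (INR 1). simpl (INR 2).
    replace (- ((INR k + 1) * t)) with (- (INR k * t) + - t) by ring.
    replace (- ((INR k + (1 + 1)) * t)) with (- (INR k * t) + - t + - t) by ring.
    rewrite !exp_plus. change (peak c t ^ S n) with (peak c t * peak c t ^ n).
    unfold peak at 4. ring.
Qed.

(* The polynomials [peak c ^ n] in [exp (- t)] concentrate at the point where
   [exp (- t) = c], and integrate [v] to zero. *)
Lemma Laplace_uniqueness (v : R -> V) (C0 C1 p : R) :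
  0 < p < 1 -> (forall t, 0 < t -> continuous v t) ->
  (forall t, 0 < t -> norm (v t) <= C0 * Rpower t (p - 1)) ->
  (forall t, 0 < t -> norm (v t) <= C1 * Rpower t (- p - 1)) ->
  (forall k : nat, is_int (fun t => scal (exp (- (INR k * t))) (v t)) zero) ->
  forall t, 0 < t -> v t = zero.
Proof.
  intros Hp Hv HC0 HC1 Hint t0 Ht0.
  apply (@norm_eq_zero R_AbsRing V).
  destruct (Rle_lt_dec (norm (v t0)) 0) as [Hle | HN]; [apply Rle_antisym; [exact Hle|apply norm_ge_0]|].
  exfalso. set (N := norm (v t0)) in *.
  set (c := exp (- t0)).
  assert (Hc : 0 < c < 1).
  { split; [apply exp_pos|]. rewrite <- exp_0. apply exp_increasing. lra. }
  (* The constant [v t0] is not integrable over the half-line; weighted by [psi], which is 1 at [t0]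
     and decays, it can be subtracted from [v]. *)
  set (psi := fun t => exp (- t) / c).
  assert (Hpsi : forall t, 0 < psi t) by (intros t; apply Rdiv_lt_0_compat; [apply exp_pos|apply Hc]).
  assert (Hpsic : forall t, continuous psi t).
  { intros t. apply (ex_derive_continuous psi). unfold psi. auto_derive. lra. }
  assert (Hpsi0 : psi t0 = 1) by (unfold psi; apply Rinv_r; lra).
  (* The constants of the exponential bound for [q = 1 - p], positive since [p < 1], and for
     [q = 1 + p]. *)
  set (K0 := Rpower (1 - p) (1 - p) / c). set (K1 := Rpower (1 + p) (1 + p) / c).
  assert (Hpsib0 : forall t, 0 < t -> psi t <= K0 * Rpower t (p - 1)).
  { intros t Ht. unfold psi, K0. assert (H := exp_neg_le_Rpower (1 - p) t ltac:(lra) Ht).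
    replace (- (1 - p)) with (p - 1) in H by ring.
    unfold Rdiv. rewrite (Rmult_assoc _ (/ c)), (Rmult_comm (/ c)), <- Rmult_assoc.
    apply Rmult_le_compat_r; [left; apply Rinv_0_lt_compat; lra|exact H]. }
  assert (Hpsib1 : forall t, 0 < t -> psi t <= K1 * Rpower t (- p - 1)).
  { intros t Ht. unfold psi, K1. assert (H := exp_neg_le_Rpower (1 + p) t ltac:(lra) Ht).
    replace (- (1 + p)) with (- p - 1) in H by ring.
    unfold Rdiv. rewrite (Rmult_assoc _ (/ c)), (Rmult_comm (/ c)), <- Rmult_assoc.
    apply Rmult_le_compat_r; [left; apply Rinv_0_lt_compat; lra|exact H]. }
  set (d := fun t => minus (v t) (scal (psi t) (v t0)) : V).
  assert (Hd : forall t, 0 < t -> continuous d t).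
  { intros t Ht. apply (continuous_minus v (fun t => scal (psi t) (v t0))); [apply Hv, Ht|].
    apply (continuous_scal_l (V := V) psi). apply Hpsic. }
  assert (Hdn : forall t, norm (d t) <= norm (v t) + psi t * N).
  { intros t. unfold d.
    eapply Rle_trans; [apply (norm_triangle (v t))|]. apply Rplus_le_compat_l.
    rewrite (norm_opp_complete (scal (psi t) (v t0))).
    rewrite (norm_scal_eq (psi t) (v t0)), Rabs_pos_eq by (left; apply Hpsi). apply Rle_refl. }
  destruct (power_dominated_integral (V := R_CompleteNormedModule) (fun t => norm (d t))
    (C0 + K0 * N) (C1 + K1 * N) p) as [D [HD _]].
  { lra. }
  { intros t Ht. apply continuous_norm, Hd, Ht. }
  { intros t Ht. change (Rabs (norm (d t)) <= (C0 + K0 * N) * Rpower t (p - 1)).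
    rewrite Rabs_pos_eq by apply norm_ge_0. eapply Rle_trans; [apply Hdn|].
    assert (H1 := HC0 t Ht). assert (H2 := Rmult_le_compat_r N _ _ (Rlt_le _ _ HN) (Hpsib0 t Ht)). lra. }
  { intros t Ht. change (Rabs (norm (d t)) <= (C1 + K1 * N) * Rpower t (- p - 1)).
    rewrite Rabs_pos_eq by apply norm_ge_0. eapply Rle_trans; [apply Hdn|].
    assert (H1 := HC1 t Ht). assert (H2 := Rmult_le_compat_r N _ _ (Rlt_le _ _ HN) (Hpsib1 t Ht)). lra. }
  assert (Hnear : exists del, 0 < del < t0 /\
    forall t, Rabs (t - t0) < del -> norm (d t) <= psi t * (N / 2)).
  { assert (Hcont : continuous (fun t => psi t * (N / 2) - norm (d t)) t0).
    { apply (continuous_minus (fun t => psi t * (N / 2)) (fun t => norm (d t))).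
      - apply (continuous_mult psi (fun _ => N / 2)); [apply Hpsic|apply continuous_const].
      - apply continuous_norm, Hd, Ht0. }
    assert (Hd0 : norm (d t0) = 0).
    { rewrite <- (@norm_zero R_AbsRing V). f_equal. unfold d. rewrite Hpsi0. vlinear V; ring. }
    assert (Hpos : 0 < psi t0 * (N / 2) - norm (d t0)) by (rewrite Hd0, Hpsi0; lra).
    destruct (proj1 (filterlim_locally _ _) Hcont (mkposreal _ Hpos)) as [e He].
    exists (Rmin e (t0 / 2)). split.
    - split; [apply Rmin_case; [apply e|lra]|]. apply Rle_lt_trans with (1 := Rmin_r _ _). lra.
    - intros t Ht. assert (H := He t (Rlt_le_trans _ _ _ Ht (Rmin_l _ _))).
      change (Rabs (psi t * (N / 2) - norm (d t) - (psi t0 * (N / 2) - norm (d t0)))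
        < psi t0 * (N / 2) - norm (d t0)) in H.
      apply Rabs_def2 in H. lra. }
  destruct Hnear as [del [Hdel Hnear]].
  (* By monotonicity, [exp (- t)] differs from [c] by at least [m] once [t] is at distance [del]
     from [t0]. *)
  set (m := Rmin (exp (- (t0 - del)) - c) (c - exp (- (t0 + del)))).
  assert (Hm : 0 < m < 1).
  { split.
    - unfold m, c. apply Rmin_case; [assert (H : exp (- t0) < exp (- (t0 - del)))|
        assert (H : exp (- (t0 + del)) < exp (- t0))]; try (apply exp_increasing); lra.
    - apply Rle_lt_trans with (1 := Rmin_r _ _). assert (H := exp_pos (- (t0 + del))). lra. }
  set (rho := 1 - m ^ 2). assert (Hrho : 0 < rho < 1) by (unfold rho; split; nra).
  assert (Hfar : forall t, 0 < t -> del <= Rabs (t - t0) -> peak c t <= rho).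
  { intros t Ht H. unfold peak, rho.
    assert (Hexp : forall x y, x <= y -> exp (- y) <= exp (- x)).
    { intros x y [Hxy | ->]; [left; apply exp_increasing; lra|right; reflexivity]. }
    assert (m ^ 2 <= (exp (- t) - c) ^ 2); [|lra].
    unfold Rabs in H. destruct (Rcase_abs (t - t0)).
    - assert (H1 := Hexp t (t0 - del) ltac:(lra)).
      assert (H2 : m <= exp (- (t0 - del)) - c) by apply Rmin_l. nra.
    - assert (H1 := Hexp (t0 + del) t ltac:(lra)).
      assert (H2 : m <= c - exp (- (t0 + del))) by apply Rmin_r. nra. }
  assert (Hpeak0 : peak c t0 = 1) by (unfold peak, c; ring).
  (* A level strictly between the far values of the peak, at most [rho], and its value 1 at [t0]. *)
  set (rho' := (1 + rho) / 2).
  assert (Hhigh : exists e, 0 < e /\ forall t, t0 <= t <= t0 + e -> rho' <= peak c t).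
  { assert (Hpos : 0 < 1 - rho') by (unfold rho'; lra).
    destruct (proj1 (filterlim_locally _ _) (continuous_peak c t0) (mkposreal _ Hpos)) as [e He].
    assert (He0 := cond_pos e). exists (e / 2). split; [lra|].
    intros t Ht. assert (Hb : Rabs (t - t0) < e) by (rewrite Rabs_pos_eq; lra).
    assert (H := He t Hb). change (Rabs (peak c t - peak c t0) < 1 - rho') in H.
    rewrite Hpeak0 in H. apply Rabs_def2 in H. lra. }
  destruct Hhigh as [e [He Hhigh]].
  apply (pow_ratio_unbounded (e * psi (t0 + e) * (N / 2)) D rho rho').
  { assert (H := Hpsi (t0 + e)). apply Rmult_lt_0_compat; [apply Rmult_lt_0_compat|]; lra. }
  { unfold rho'. lra. }
  intros n.
  assert (Hpc : forall t, continuous (fun t => peak c t ^ n) t).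
  { intros t. apply (ex_derive_continuous (fun t => peak c t ^ n)). unfold peak. auto_derive. exact I. }
  assert (Hpn : forall t, 0 < t -> 0 <= peak c t ^ n <= 1).
  { intros t Ht. destruct (peak_bounds c t Hc Ht) as [H1 H2]. split; [apply pow_le, H1|].
    rewrite <- (pow1 n). apply pow_incr. lra. }
  set (j := fun t => peak c t ^ n * psi t).
  assert (Hj : forall t, 0 < t -> continuous j t).
  { intros t _. apply (continuous_mult (fun t => peak c t ^ n) psi); [apply Hpc|apply Hpsic]. }
  assert (Hj0 : forall t, 0 < t -> 0 <= j t <= psi t).
  { intros t Ht. specialize (Hpn t Ht). specialize (Hpsi t). unfold j. split.
    - apply Rmult_le_pos; lra.
    - rewrite <- (Rmult_1_l (psi t)) at 2. apply Rmult_le_compat_r; lra. }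
  destruct (power_dominated_integral (V := R_CompleteNormedModule) j K0 K1 p) as [J [HJ _]].
  { lra. }
  { exact Hj. }
  { intros t Ht. change (Rabs (j t) <= K0 * Rpower t (p - 1)).
    rewrite Rabs_pos_eq by (apply Hj0, Ht). eapply Rle_trans; [apply Hj0, Ht|apply Hpsib0, Ht]. }
  { intros t Ht. change (Rabs (j t) <= K1 * Rpower t (- p - 1)).
    rewrite Rabs_pos_eq by (apply Hj0, Ht). eapply Rle_trans; [apply Hj0, Ht|apply Hpsib1, Ht]. }
  assert (HJlow : e * psi (t0 + e) * rho' ^ n <= J).
  { eapply Rle_trans; [|apply (RInt_le_is_int j t0 (t0 + e) J); [exact Hj|intros; apply Hj0; assumption|lra|exact HJ]].
    replace (e * psi (t0 + e) * rho' ^ n) with (RInt (fun _ => rho' ^ n * psi (t0 + e)) t0 (t0 + e))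
      by (rewrite RInt_const; unfold scal; simpl; unfold mult; simpl; ring).
    apply RInt_le.
    - lra.
    - apply (ex_RInt_const (V := R_NormedModule)).
    - apply (ex_RInt_half_line (V := R_CompleteNormedModule)); [exact Hj|lra|lra].
    - intros t Ht. unfold j. apply Rmult_le_compat.
      + apply pow_le. unfold rho'. lra.
      + left; apply Hpsi.
      + apply pow_incr. split; [unfold rho'; lra|apply Hhigh; lra].
      + unfold psi. apply Rmult_le_compat_r; [left; apply Rinv_0_lt_compat; lra|].
        left. apply exp_increasing. lra. }
  (* The part of [d] coming from [v] integrates to zero, so the total is a vector of norm
     [N * J]. *)
  assert (Hz : is_int (fun t => scal (peak c t ^ n) (d t)) (minus zero (scal J (v t0)))).
  { assert (H1 := is_int_peak_pow_zero v c Hint n O).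
    assert (H2 : is_int (fun t => scal (j t) (v t0)) (scal J (v t0))).
    { apply is_int_scal_l, HJ. }
    generalize (is_RInt_gen_minus _ _ _ _ H1 H2). apply is_int_ext.
    intros t _. unfold d, j. simpl (INR 0). rewrite Rmult_0_l, Ropp_0, exp_0. vlinear V; ring. }
  assert (Hcmp : is_int (fun t => (N / 2) * j t + rho ^ n * norm (d t)) ((N / 2) * J + rho ^ n * D)).
  { apply (is_RInt_gen_plus (V := R_NormedModule) (fun t => (N / 2) * j t) (fun t => rho ^ n * norm (d t))).
    - apply (is_RInt_gen_scal (V := R_NormedModule) j), HJ.
    - apply (is_RInt_gen_scal (V := R_NormedModule) (fun t => norm (d t))), HD. }
  (* Near [t0] the difference [d] is at most half of [psi * N]; away from [t0] the factor
     [peak c t ^ n] is at most [rho ^ n]. Since [J] is at least a multiple of [rho' ^ n], this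
     cannot hold for all [n]. *)
  assert (Hfin : N * J <= (N / 2) * J + rho ^ n * D).
  { replace (N * J) with (norm (minus zero (scal J (v t0)))).
    2:{ transitivity (norm (scal J (v t0))).
        - rewrite <- norm_opp_complete. f_equal. vlinear V; ring.
        - rewrite (norm_scal_eq J (v t0)), Rabs_pos_eq; [unfold N; ring|].
          eapply Rle_trans; [|exact HJlow]. left.
          assert (H := Hpsi (t0 + e)). apply Rmult_lt_0_compat; [apply Rmult_lt_0_compat; lra|].
          apply pow_lt. unfold rho'. lra. }
    refine (is_int_norm_le _ _ _ _ _ Hz Hcmp).
    intros t Ht. rewrite (norm_scal_eq (peak c t ^ n) (d t)).
    rewrite Rabs_pos_eq by (apply Hpn, Ht). unfold j.
    assert (H1 := norm_ge_0 (d t)). assert (H2 := Hpn t Ht). assert (H3 := Hpsi t).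
    assert (H4 : 0 < rho ^ n) by (apply pow_lt; lra).
    destruct (Rlt_le_dec (Rabs (t - t0)) del) as [H | H].
    - specialize (Hnear t H). nra.
    - assert (H5 : peak c t ^ n <= rho ^ n).
      { apply pow_incr. split; [apply peak_bounds; assumption|apply Hfar; assumption]. }
      assert (0 <= N / 2 * (peak c t ^ n * psi t)); [|nra].
      apply Rmult_le_pos; [|apply Rmult_le_pos]; lra. }
  assert (H : (N / 2) * (e * psi (t0 + e) * rho' ^ n) <= N / 2 * J) by (apply Rmult_le_compat_l; lra).
  lra.
Qed.

End LaplaceUniqueness.

(** * Moments of a Laplace transform *)

Lemma abs_mean_value_le (f f' : R -> R) (x y B : R) :
  (forall z, Rmin x y <= z <= Rmax x y -> is_derive f z (f' z)) ->
  (forall z, Rmin x y <= z <= Rmax x y -> Rabs (f' z) <= B) ->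
  Rabs (f y - f x) <= B * Rabs (y - x).
Proof.
  intros Hd HB.
  destruct (MVT_gen f x y f') as [c [Hc E]].
  - intros z Hz. apply Hd. lra.
  - intros z Hz. apply continuity_pt_filterlim.
    apply (ex_derive_continuous f). eexists. apply Hd, Hz.
  - rewrite E, Rabs_mult. apply Rmult_le_compat_r; [apply Rabs_pos|apply HB, Hc].
Qed.

Section MomentFormula.

Context {V : CompleteNormedModule R_AbsRing}.

(** Differentiation under the integral sign enters here: a Taylor remainder of the integrand,
    integrated against [g], supplies the quadratic bound. *)
Lemma is_derive_quadratic (H : R -> V) (l : V) (x r B : R) :
  0 < r ->
  (forall y, Rabs (y - x) < r ->
    norm (minus (minus (H y) (H x)) (scal (y - x) l)) <= B * (y - x) ^ 2) ->
  is_derive H x l.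
Proof.
  intros Hr HB. split; [apply (is_linear_scal_l (V := V))|].
  intros y Hy. apply (@is_filter_lim_locally_unique R_AbsRing R_NormedModule) in Hy. subst y.
  intros eps. set (B' := Rabs B + 1). assert (HB' : 0 < B') by (unfold B'; assert (K := Rabs_pos B); lra).
  assert (Hd : 0 < Rmin r (eps / B')).
  { apply Rmin_case; [exact Hr|apply Rdiv_lt_0_compat; [apply eps|exact HB']]. }
  exists (mkposreal _ Hd). intros y Hy. change (Rabs (y - x) < Rmin r (eps / B')) in Hy.
  change (norm (minus (minus (H y) (H x)) (scal (y - x) l)) <= eps * Rabs (y - x)).
  eapply Rle_trans; [apply HB, (Rlt_le_trans _ _ _ Hy), Rmin_l|].
  apply Rle_trans with (B' * (y - x) ^ 2).
  - apply Rmult_le_compat_r; [apply pow2_ge_0|]. unfold B'. assert (K := Rle_abs B). lra.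
  - rewrite <- (pow2_abs (y - x)). simpl. rewrite Rmult_1_r, <- Rmult_assoc.
    apply Rmult_le_compat_r; [apply Rabs_pos|].
    apply Rmult_le_reg_l with (/ B'); [apply Rinv_0_lt_compat, HB'|].
    rewrite <- Rmult_assoc, Rinv_l, Rmult_1_l, Rmult_comm by lra.
    left. apply (Rlt_le_trans _ _ _ Hy), Rmin_r.
Qed.

Lemma continuous_lipschitz (H : R -> V) (x r B : R) :
  0 < r -> (forall y, Rabs (y - x) < r -> norm (minus (H y) (H x)) <= B * Rabs (y - x)) ->
  continuous H x.
Proof.
  intros Hr HB. apply filterlim_locally. intros eps.
  set (B' := Rabs B + 1). assert (HB' : 0 < B') by (unfold B'; assert (K := Rabs_pos B); lra).
  assert (Hd : 0 < Rmin r (eps / B')).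
  { apply Rmin_case; [exact Hr|apply Rdiv_lt_0_compat; [apply eps|exact HB']]. }
  exists (mkposreal _ Hd). intros y Hy. change (Rabs (y - x) < Rmin r (eps / B')) in Hy.
  apply (@norm_compat1 R_AbsRing V).
  eapply Rle_lt_trans; [apply HB, (Rlt_le_trans _ _ _ Hy), Rmin_l|].
  apply Rle_lt_trans with (B' * Rabs (y - x)).
  - apply Rmult_le_compat_r; [apply Rabs_pos|]. unfold B'. assert (K := Rle_abs B). lra.
  - apply Rmult_lt_reg_l with (/ B'); [apply Rinv_0_lt_compat, HB'|].
    rewrite <- Rmult_assoc, Rinv_l, Rmult_1_l, Rmult_comm by lra.
    apply (Rlt_le_trans _ _ _ Hy), Rmin_r.
Qed.

Lemma abs_int_of_power_bounds (f : R -> V) (C0 C1 p : R) :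
  0 < p -> (forall t, 0 < t -> continuous f t) ->
  (forall t, 0 < t -> norm (f t) <= C0 * Rpower t (p - 1)) ->
  (forall t, 0 < t -> norm (f t) <= C1 * Rpower t (- p - 1)) ->
  ex_RInt_gen (fun t => norm (f t)) (at_right 0) (Rbar_locally p_infty).
Proof.
  intros Hp Hf H0 H1.
  destruct (power_dominated_norm_le (V := R_CompleteNormedModule) (fun t => norm (f t)) C0 C1 p Hp)
    as [l [Hl _]].
  - intros t Ht. apply continuous_norm, Hf, Ht.
  - intros t Ht. change (Rabs (norm (f t)) <= C0 * Rpower t (p - 1)).
    rewrite Rabs_pos_eq by apply norm_ge_0. apply H0, Ht.
  - intros t Ht. change (Rabs (norm (f t)) <= C1 * Rpower t (- p - 1)).
    rewrite Rabs_pos_eq by apply norm_ge_0. apply H1, Ht.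
  - exists l. exact Hl.
Qed.

Variables (alpha sigma C : R) (g : R -> V) (L : R -> V).
Hypothesis Halpha : 0 <= alpha.
Hypothesis Hsigma : 0 < sigma < 1.
Hypothesis HC : 0 <= C.
Hypothesis Hg : forall t, 0 < t -> continuous g t.
Hypothesis Hg0 : forall t, 0 < t -> norm (g t) <= C * Rpower t (alpha + 1).
Hypothesis Hg1 : forall t, 0 < t -> norm (g t) <= C * Rpower t alpha.
Hypothesis HL : forall x, 0 < x -> is_int (fun t => scal (exp (- (x * t))) (g t)) (L x).

Let s := sigma + alpha + 1.

(** The two bounds on [g] give the exponents [alpha + 1 - q] and [alpha - q]; the conditions on [p]
    say that [p - 1] and [- p - 1] lie between them. *)
Lemma weighted_bound (q p B t k : R) :
  0 < p -> p <= q - alpha - 1 -> p <= alpha + 2 - q -> 0 <= B -> 0 < t ->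
  Rabs k <= B * Rpower t (- q) ->
  norm (scal k (g t)) <= B * C * Rpower t (p - 1) /\
  norm (scal k (g t)) <= B * C * Rpower t (- p - 1).
Proof.
  intros Hp Hp1 Hp2 HB Ht Hk. rewrite norm_scal_eq.
  assert (HBC : 0 <= B * C) by (apply Rmult_le_pos; assumption).
  assert (E : forall a, norm (g t) <= C * Rpower t a ->
    Rabs k * norm (g t) <= B * C * Rpower t (a - q)).
  { intros a Ha. replace (a - q) with (- q + a) by ring. rewrite Rpower_plus.
    replace (B * C * (Rpower t (- q) * Rpower t a)) with (B * Rpower t (- q) * (C * Rpower t a)) by ring.
    apply Rmult_le_compat; auto using Rabs_pos, norm_ge_0. }
  assert (E0 := E _ (Hg0 t Ht)). assert (E1 := E _ (Hg1 t Ht)).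
  split; apply (Rpower_interpolation (B * C) _ t (alpha - q) (alpha + 1 - q)); auto; lra.
Qed.

(** [K] is chosen before the kernel [k], so errors depending on [x], [y] or on the ends of an
    interval are controlled by [B] alone. Two exponents are allowed because the truncation error of
    the Gamma integral has one term for each end. *)
Lemma weighted_integral (q0 q1 : R) :
  alpha + 1 < q0 < alpha + 2 -> alpha + 1 < q1 < alpha + 2 ->
  exists K, 0 <= K /\ forall (k : R -> R) (B : R),
    0 <= B -> (forall t, 0 < t -> continuous k t) ->
    (forall t, 0 < t -> Rabs (k t) <= B * (Rpower t (- q0) + Rpower t (- q1))) ->
    exists l : V, is_int (fun t => scal (k t) (g t)) l /\ norm l <= B * K.
Proof.
  intros Hq0 Hq1.
  set (p := Rmin (Rmin (q0 - alpha - 1) (alpha + 2 - q0)) (Rmin (q1 - alpha - 1) (alpha + 2 - q1))).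
  assert (Hp : 0 < p) by (unfold p; repeat apply Rmin_case; lra).
  assert (P1 : p <= Rmin (q0 - alpha - 1) (alpha + 2 - q0)) by apply Rmin_l.
  assert (P2 : p <= Rmin (q1 - alpha - 1) (alpha + 2 - q1)) by apply Rmin_r.
  assert (P3 := Rmin_l (q0 - alpha - 1) (alpha + 2 - q0)). assert (P4 := Rmin_r (q0 - alpha - 1) (alpha + 2 - q0)).
  assert (P5 := Rmin_l (q1 - alpha - 1) (alpha + 2 - q1)). assert (P6 := Rmin_r (q1 - alpha - 1) (alpha + 2 - q1)).
  exists (4 * C / p). split.
  { apply Rmult_le_pos; [lra|]. left. apply Rinv_0_lt_compat, Hp. }
  intros k B HB Hk Hkb.
  assert (Hbound : forall t, 0 < t -> norm (scal (k t) (g t)) <= 2 * (B * C) * Rpower t (p - 1)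
    /\ norm (scal (k t) (g t)) <= 2 * (B * C) * Rpower t (- p - 1)).
  { intros t Ht.
    assert (W : forall q, p <= q - alpha - 1 -> p <= alpha + 2 - q ->
      B * Rpower t (- q) * norm (g t) <= B * C * Rpower t (p - 1) /\
      B * Rpower t (- q) * norm (g t) <= B * C * Rpower t (- p - 1)).
    { intros q A1 A2.
      assert (Habs : Rabs (B * Rpower t (- q)) = B * Rpower t (- q)).
      { apply Rabs_pos_eq, Rmult_le_pos; [exact HB|left; apply Rpower_pos]. }
      assert (W := weighted_bound q p B t (B * Rpower t (- q)) Hp A1 A2 HB Ht (Req_le _ _ Habs)).
      rewrite norm_scal_eq, Habs in W. exact W. }
    destruct (W q0 ltac:(lra) ltac:(lra)) as [W1 W2]. destruct (W q1 ltac:(lra) ltac:(lra)) as [W3 W4].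
    assert (E : norm (scal (k t) (g t)) <= B * Rpower t (- q0) * norm (g t) + B * Rpower t (- q1) * norm (g t)).
    { rewrite norm_scal_eq.
      replace (B * Rpower t (- q0) * norm (g t) + B * Rpower t (- q1) * norm (g t))
        with (B * (Rpower t (- q0) + Rpower t (- q1)) * norm (g t)) by ring.
      apply Rmult_le_compat_r; [apply norm_ge_0|apply Hkb, Ht]. }
    lra. }
  destruct (power_dominated_norm_le (fun t => scal (k t) (g t)) (2 * (B * C)) (2 * (B * C)) p Hp)
    as [l [Hl Hn]].
  - intros t Ht. apply (continuous_scal k g); [apply Hk, Ht|apply Hg, Ht].
  - intros t Ht. apply Hbound, Ht.
  - intros t Ht. apply Hbound, Ht.
  - exists l. split; [exact Hl|]. apply Rle_trans with (1 := Hn). right. field. lra.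
Qed.

Lemma weighted_integral_single (q : R) :
  alpha + 1 < q < alpha + 2 ->
  exists K, 0 <= K /\ forall (k : R -> R) (B : R),
    0 <= B -> (forall t, 0 < t -> continuous k t) ->
    (forall t, 0 < t -> Rabs (k t) <= B * Rpower t (- q)) ->
    exists l : V, is_int (fun t => scal (k t) (g t)) l /\ norm l <= B * K.
Proof.
  intros Hq. destruct (weighted_integral q q Hq Hq) as [K [HK H]].
  exists K. split; [exact HK|]. intros k B HB Hk Hb. apply H; auto.
  intros t Ht. apply Rle_trans with (1 := Hb t Ht).
  apply Rmult_le_compat_l; [exact HB|]. assert (P := Rpower_pos t (- q)). lra.
Qed.

Lemma weighted_norm_le (q : R) :
  alpha + 1 < q < alpha + 2 ->
  exists K, 0 <= K /\ forall (k : R -> R) (B : R) (l : V),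
    0 <= B -> (forall t, 0 < t -> continuous k t) ->
    (forall t, 0 < t -> Rabs (k t) <= B * Rpower t (- q)) ->
    is_int (fun t => scal (k t) (g t)) l -> norm l <= B * K.
Proof.
  intros Hq. destruct (weighted_integral_single q Hq) as [K [HK H]].
  exists K. split; [exact HK|]. intros k B l HB Hk Hb Hl.
  destruct (H k B HB Hk Hb) as [l' [Hl' Hn]].
  rewrite <- (is_int_unique _ _ Hl), (is_int_unique _ _ Hl'). exact Hn.
Qed.

(** * Taylor estimates in [x] for the kernel and its primitive *)

Let kernel (x t : R) : R := Rpower x (s - 1) * exp (- (x * t)).

Let kernel' (x t : R) : R :=
  (s - 1) * Rpower x (s - 2) * exp (- (x * t)) - t * Rpower x (s - 1) * exp (- (x * t)).

(** The sum of the constants bounding the two terms of [kernel']: the exponential bound at [x * t]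
    is taken with [q = s] for the first and [q = s + 1] for the second, where it also absorbs the
    factor [t]. *)
Let M : R := (s - 1) * Rpower s s + Rpower (s + 1) (s + 1).

Lemma is_derive_kernel (x t : R) : 0 < x -> is_derive (fun x => kernel x t) x (kernel' x t).
Proof.
  intros Hx. unfold kernel, kernel'.
  evar_last.
  { apply (is_derive_mult (fun x => Rpower x (s - 1)) (fun x => exp (- (x * t)))).
    - apply is_derive_Rpower, Hx.
    - auto_derive; [exact I|reflexivity].
    - intros; apply Rmult_comm. }
  unfold plus, mult; simpl. replace (s - 1 - 1) with (s - 2) by ring. ring.
Qed.

Lemma kernel_bound_pos : 0 < M.
Proof.
  unfold M, s. assert (P1 := Rpower_pos (sigma + alpha + 1) (sigma + alpha + 1)).
  assert (P2 := Rpower_pos (sigma + alpha + 1 + 1) (sigma + alpha + 1 + 1)). nra.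
Qed.

Lemma kernel'_le (m x t : R) :
  0 < m <= x -> 0 < t -> Rabs (kernel' x t) <= M / m ^ 2 * Rpower t (- s).
Proof.
  intros Hx Ht. assert (Hs : 1 < s) by (unfold s; lra).
  assert (Hxt : 0 < x * t) by (apply Rmult_lt_0_compat; lra).
  assert (E1 := exp_neg_le_Rpower s (x * t) ltac:(lra) Hxt).
  assert (E2 := exp_neg_le_Rpower (s + 1) (x * t) ltac:(lra) Hxt).
  rewrite <- Rpower_mult_distr in E1, E2 by lra.
  assert (P0 := Rpower_pos x (s - 2)). assert (P1 := Rpower_pos t (- s)).
  assert (P2 := exp_pos (- (x * t))). assert (P3 := Rpower_pos x (s - 1)).
  assert (X1 : Rpower x (s - 2) * Rpower x (- s) = / x ^ 2).
  { rewrite <- Rpower_plus. replace (s - 2 + - s) with (- INR 2) by (simpl; ring).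
    rewrite Rpower_Ropp, Rpower_pow; [reflexivity|lra]. }
  assert (X2 : Rpower x (s - 1) * Rpower x (- (s + 1)) = / x ^ 2).
  { rewrite <- Rpower_plus. replace (s - 1 + - (s + 1)) with (- INR 2) by (simpl; ring).
    rewrite Rpower_Ropp, Rpower_pow; [reflexivity|lra]. }
  assert (X3 : t * Rpower t (- (s + 1)) = Rpower t (- s)).
  { rewrite <- Rpower_add_1 by exact Ht. f_equal. ring. }
  assert (A1 : (s - 1) * Rpower x (s - 2) * exp (- (x * t)) <= (s - 1) * Rpower s s * / x ^ 2 * Rpower t (- s)).
  { rewrite <- X1.
    replace ((s - 1) * Rpower s s * (Rpower x (s - 2) * Rpower x (- s)) * Rpower t (- s))
      with ((s - 1) * Rpower x (s - 2) * (Rpower s s * (Rpower x (- s) * Rpower t (- s)))) by ring.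
    apply Rmult_le_compat_l; [apply Rmult_le_pos; lra|exact E1]. }
  assert (A2 : t * Rpower x (s - 1) * exp (- (x * t)) <= Rpower (s + 1) (s + 1) * / x ^ 2 * Rpower t (- s)).
  { rewrite <- X2, <- X3.
    replace (Rpower (s + 1) (s + 1) * (Rpower x (s - 1) * Rpower x (- (s + 1))) * (t * Rpower t (- (s + 1))))
      with (t * Rpower x (s - 1) * (Rpower (s + 1) (s + 1) * (Rpower x (- (s + 1)) * Rpower t (- (s + 1))))) by ring.
    apply Rmult_le_compat_l; [apply Rmult_le_pos; lra|exact E2]. }
  assert (B1 : 0 <= (s - 1) * Rpower x (s - 2) * exp (- (x * t))) by (repeat apply Rmult_le_pos; lra).
  assert (B2 : 0 <= t * Rpower x (s - 1) * exp (- (x * t))) by (repeat apply Rmult_le_pos; lra).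
  assert (Hm : / x ^ 2 <= / m ^ 2) by (apply Rinv_le_contravar; [apply pow_lt|apply pow_incr]; lra).
  apply Rle_trans with (M * Rpower t (- s) * / x ^ 2).
  - unfold kernel'. unfold M. apply Rabs_le. lra.
  - replace (M / m ^ 2 * Rpower t (- s)) with (M * Rpower t (- s) * / m ^ 2) by (unfold Rdiv; ring).
    apply Rmult_le_compat_l; [|exact Hm]. apply Rmult_le_pos; [left; apply kernel_bound_pos|lra].
Qed.

Lemma kernel_lipschitz (m x y t : R) :
  0 < m -> m <= x -> m <= y -> 0 < t ->
  Rabs (kernel y t - kernel x t) <= M / m ^ 2 * Rpower t (- s) * Rabs (y - x).
Proof.
  intros Hm Hx Hy Ht. apply abs_mean_value_le with (f := fun x => kernel x t) (f' := fun x => kernel' x t).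
  - intros z Hz. apply is_derive_kernel. apply Rlt_le_trans with (2 := proj1 Hz). apply Rmin_case; lra.
  - intros z Hz. apply kernel'_le; [|exact Ht]. split; [exact Hm|].
    apply Rle_trans with (2 := proj1 Hz). apply Rmin_case; lra.
Qed.

(** An incomplete gamma function based at 1, which keeps the integral away from the end 0; it is
    negative for [x < 1], and only its differences matter in the end. *)
Let lower (x : R) : R := RInt (gamma_density s) 1 x.

Lemma is_derive_lower_gamma (x : R) : 0 < x -> is_derive lower x (gamma_density s x).
Proof.
  intros Hx. apply (is_derive_RInt (gamma_density s) lower 1 x).
  - exists (mkposreal x Hx). intros y Hy. change (Rabs (y - x) < x) in Hy. apply Rabs_def2 in Hy.
    apply (RInt_correct (V := R_CompleteNormedModule)).
    apply (ex_RInt_half_line (V := R_CompleteNormedModule)); [apply continuous_gamma_density|lra|lra].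
  - apply continuous_gamma_density, Hx.
Qed.

Lemma lower_gamma_diff (x y : R) : 0 < x -> 0 < y -> lower y - lower x = RInt (gamma_density s) x y.
Proof.
  intros Hx Hy. unfold lower.
  assert (E : forall a b, 0 < a -> 0 < b -> ex_RInt (gamma_density s) a b).
  { intros a b. apply (ex_RInt_half_line (V := R_CompleteNormedModule)), continuous_gamma_density. }
  rewrite <- (RInt_Chasles (V := R_CompleteNormedModule) (gamma_density s) 1 x y) by (apply E; lra).
  unfold plus; simpl. ring.
Qed.

Lemma lower_gamma_le (x : R) : 0 < x -> Rabs (lower x) <= Gamma s.
Proof.
  intros Hx.
  assert (Hs : 0 < s) by (unfold s; lra).
  assert (B : forall a b, 0 < a <= b -> 0 <= RInt (gamma_density s) a b <= Gamma s).
  { intros a b Hab. split.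
    - apply RInt_ge_0; [lra| |intros; left; apply gamma_density_pos].
      apply (ex_RInt_half_line (V := R_CompleteNormedModule)); [apply continuous_gamma_density|lra|lra].
    - apply RInt_le_is_int; [apply continuous_gamma_density|intros; left; apply gamma_density_pos|exact Hab|].
      apply Gamma_integral, Hs. }
  unfold lower. destruct (Rle_lt_dec 1 x) as [H | H].
  - specialize (B 1 x ltac:(lra)). rewrite Rabs_pos_eq; lra.
  - specialize (B x 1 ltac:(lra)).
    rewrite <- (opp_RInt_swap (V := R_CompleteNormedModule) (gamma_density s) x 1).
    + change (Rabs (- RInt (gamma_density s) x 1) <= Gamma s). rewrite Rabs_Ropp, Rabs_pos_eq; lra.
    + apply (ex_RInt_half_line (V := R_CompleteNormedModule)); [apply continuous_gamma_density|lra|lra].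
Qed.

(** The substitution [u = x t] turns the integral of the kernel in [x] into [t^(-s)] times an
    incomplete gamma function. *)
Let primitive (x t : R) : R := Rpower t (- s) * lower (x * t).

Lemma is_derive_primitive (x t : R) :
  0 < x -> 0 < t -> is_derive (fun x => primitive x t) x (kernel x t).
Proof.
  intros Hx Ht. unfold primitive, kernel.
  evar_last.
  { apply (is_derive_scal (fun x => lower (x * t))).
    apply (is_derive_comp lower (fun x => x * t)).
    - apply is_derive_lower_gamma. apply Rmult_lt_0_compat; assumption.
    - auto_derive; [exact I|reflexivity]. }
  unfold scal; simpl; unfold mult; simpl. unfold gamma_density.
  rewrite <- Rpower_mult_distr by assumption.
  rewrite Rpower_Ropp, (Rpower_sub_1 t) by assumption.
  field. split; [lra|]. apply Rgt_not_eq, Rpower_pos.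
Qed.

Lemma primitive_taylor (m x y t : R) :
  0 < m -> m <= x -> m <= y -> 0 < t ->
  Rabs (primitive y t - primitive x t - (y - x) * kernel x t)
    <= M / m ^ 2 * (y - x) ^ 2 * Rpower t (- s).
Proof.
  intros Hm Hx Hy Ht.
  (* Its derivative [kernel z t - kernel x t] is already Lipschitz-small, so the mean value
     inequality yields the second factor [y - x]. *)
  set (f := fun z => primitive z t - z * kernel x t).
  replace (primitive y t - primitive x t - (y - x) * kernel x t) with (f y - f x) by (unfold f; ring).
  rewrite <- (pow2_abs (y - x)).
  replace (M / m ^ 2 * Rabs (y - x) ^ 2 * Rpower t (- s))
    with (M / m ^ 2 * Rpower t (- s) * Rabs (y - x) * Rabs (y - x)) by ring.
  assert (Hz : forall z, Rmin x y <= z <= Rmax x y -> m <= z /\ Rabs (z - x) <= Rabs (y - x)).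
  { intros z. unfold Rmin, Rmax. destruct (Rle_dec x y); intros; split; try lra.
    - rewrite !Rabs_pos_eq; lra.
    - rewrite !Rabs_left1; lra. }
  apply abs_mean_value_le with (f' := fun z => kernel z t - kernel x t).
  - intros z H. apply Hz in H. unfold f.
    apply (is_derive_minus (fun z => primitive z t) (fun z => z * kernel x t)).
    + apply is_derive_primitive; lra.
    + auto_derive; [exact I|ring].
  - intros z H. destruct (Hz z H) as [H1 H2].
    eapply Rle_trans; [apply (kernel_lipschitz m); lra|].
    apply Rmult_le_compat_l; [|exact H2].
    apply Rmult_le_pos; [|left; apply Rpower_pos].
    left. apply Rdiv_lt_0_compat; [apply kernel_bound_pos|apply pow_lt, Hm].
Qed.

Lemma continuous_kernel (x t : R) : continuous (kernel x) t.
Proof.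
  apply (ex_derive_continuous (kernel x)). unfold kernel. auto_derive. exact I.
Qed.

Lemma continuous_primitive (x t : R) : 0 < x -> 0 < t -> continuous (primitive x) t.
Proof.
  intros Hx Ht. apply (continuous_mult (fun t => Rpower t (- s)) (fun t => lower (x * t))).
  - apply continuous_Rpower, Ht.
  - apply (continuous_comp (fun t => x * t) lower).
    + apply (ex_derive_continuous (fun t => x * t)). auto_derive. exact I.
    + apply (ex_derive_continuous lower). eexists. apply is_derive_lower_gamma.
      apply Rmult_lt_0_compat; assumption.
Qed.

(** * The weighted Laplace transform and its integral *)

Let l (x : R) : V := scal (Rpower x (s - 1)) (L x).

Lemma is_int_weighted_Laplace (x : R) : 0 < x -> is_int (fun t => scal (kernel x t) (g t)) (l x).
Proof.
  intros Hx. generalize (is_int_scal _ (Rpower x (s - 1)) _ (HL x Hx)). apply is_int_ext.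
  intros t Ht. unfold kernel. vlinear V; ring.
Qed.

Lemma exponent_range : alpha + 1 < s < alpha + 2.
Proof. unfold s. lra. Qed.

Lemma continuous_weighted_Laplace (x : R) : 0 < x -> continuous l x.
Proof.
  intros Hx. destruct (weighted_norm_le s exponent_range) as [K [HK H]].
  (* Within radius [x / 2] all points stay above [m = x / 2], where the kernel estimates are
     uniform. *)
  apply (continuous_lipschitz l x (x / 2) (M / (x / 2) ^ 2 * K)); [lra|].
  intros y Hy. apply Rabs_def2 in Hy.
  replace (M / (x / 2) ^ 2 * K * Rabs (y - x)) with (M / (x / 2) ^ 2 * Rabs (y - x) * K) by ring.
  apply (H (fun t => kernel y t - kernel x t)).
  - apply Rmult_le_pos; [|apply Rabs_pos]. left. apply Rdiv_lt_0_compat; [apply kernel_bound_pos|apply pow_lt; lra].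
  - intros t _. apply (continuous_minus (kernel y) (kernel x)); apply continuous_kernel.
  - intros t Ht. rewrite Rmult_assoc, (Rmult_comm (Rabs _)), <- Rmult_assoc.
    apply kernel_lipschitz; lra.
  - generalize (is_int_minus _ _ _ _ (is_int_weighted_Laplace y ltac:(lra)) (is_int_weighted_Laplace x Hx)).
    apply is_int_ext. intros t _. vlinear V; ring.
Qed.

(** With [q] slightly below and slightly above [s] this gives exponents just above and just below
    -1, hence integrability at 0 and at infinity. *)
Lemma weighted_Laplace_decay (q : R) :
  alpha + 1 < q < alpha + 2 ->
  exists K, forall x, 0 < x -> norm (l x) <= K * Rpower x (s - 1 - q).
Proof.
  intros Hq. destruct (weighted_norm_le q Hq) as [K [HK H]].
  exists (Rpower q q * K). intros x Hx. unfold l. rewrite norm_scal_eq.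
  rewrite Rabs_pos_eq by (left; apply Rpower_pos).
  replace (s - 1 - q) with (s - 1 + - q) by ring. rewrite Rpower_plus.
  replace (Rpower q q * K * (Rpower x (s - 1) * Rpower x (- q)))
    with (Rpower x (s - 1) * (Rpower q q * Rpower x (- q) * K)) by ring.
  apply Rmult_le_compat_l; [left; apply Rpower_pos|].
  apply (H (fun t => exp (- (x * t)))).
  - left. apply Rmult_lt_0_compat; apply Rpower_pos.
  - intros t _. apply continuous_exp_scaled.
  - intros t Ht. rewrite Rabs_pos_eq by (left; apply exp_pos).
    rewrite Rmult_assoc, Rpower_mult_distr by assumption.
    apply exp_neg_le_Rpower; [lra|apply Rmult_lt_0_compat; assumption].
  - apply HL, Hx.
Qed.

Lemma primitive_integral :
  exists H : R -> V, forall x, 0 < x -> is_int (fun t => scal (primitive x t) (g t)) (H x).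
Proof.
  exists (fun x => RInt_gen (fun t => scal (primitive x t) (g t)) (at_right 0) (Rbar_locally p_infty)).
  intros x Hx. apply (RInt_gen_correct (fun t => scal (primitive x t) (g t))).
  destruct (weighted_integral_single s exponent_range) as [K [HK H]].
  destruct (H (primitive x) (Gamma s)) as [I [HI _]].
  - left. apply Gamma_gt_0. unfold s; lra.
  - intros t Ht. apply continuous_primitive; assumption.
  - intros t Ht. unfold primitive. rewrite Rabs_mult, Rabs_pos_eq by (left; apply Rpower_pos).
    rewrite Rmult_comm. apply Rmult_le_compat_r; [left; apply Rpower_pos|].
    apply lower_gamma_le, Rmult_lt_0_compat; assumption.
  - exists I. exact HI.
Qed.

Lemma Laplace_moment_formula :
  exists I : V,
    is_int (fun t => scal (Rpower t (- s)) (g t)) I /\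
    ex_RInt_gen (fun t => norm (scal (Rpower t (- s)) (g t))) (at_right 0) (Rbar_locally p_infty) /\
    is_int (fun x => scal (Rpower x (s - 1)) (L x)) (scal (Gamma s) I) /\
    ex_RInt_gen (fun x => norm (scal (Rpower x (s - 1)) (L x))) (at_right 0) (Rbar_locally p_infty).
Proof.
  (* Half the distance from [s] to the nearer end of its interval, so that [s - e] and [s + e]
     remain admissible exponents. *)
  set (e := Rmin sigma (1 - sigma) / 2).
  assert (He : 0 < e /\ e < sigma /\ e < 1 - sigma).
  { unfold e. assert (A1 := Rmin_l sigma (1 - sigma)). assert (A2 := Rmin_r sigma (1 - sigma)).
    assert (0 < Rmin sigma (1 - sigma)) by (apply Rmin_case; lra). lra. }
  assert (Hs := exponent_range).
  assert (Hpow : forall t, 0 < t -> continuous (fun t => Rpower t (- s)) t).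
  { intros t Ht. apply continuous_Rpower, Ht. }
  assert (Hgb : forall t, 0 < t ->
    norm (scal (Rpower t (- s)) (g t)) <= 1 * C * Rpower t (e - 1) /\
    norm (scal (Rpower t (- s)) (g t)) <= 1 * C * Rpower t (- e - 1)).
  { intros t Ht. apply (weighted_bound s); unfold s; try lra.
    rewrite Rabs_pos_eq by (left; apply Rpower_pos). unfold s. lra. }
  assert (Hgc : forall t, 0 < t -> continuous (fun t => scal (Rpower t (- s)) (g t)) t).
  { intros t Ht. apply (continuous_scal (fun t => Rpower t (- s)) g); [apply Hpow, Ht|apply Hg, Ht]. }
  destruct (power_dominated_norm_le (fun t => scal (Rpower t (- s)) (g t)) (1 * C) (1 * C) e)
    as [I [HI _]]; [lra|exact Hgc|intros; apply Hgb; assumption|intros; apply Hgb; assumption|].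
  exists I. split; [exact HI|]. split.
  { apply (abs_int_of_power_bounds _ (1 * C) (1 * C) e);
      [lra|exact Hgc|intros; apply Hgb; assumption|intros; apply Hgb; assumption]. }
  change (fun x => scal (Rpower x (s - 1)) (L x)) with l.
  split.
  2:{ destruct (weighted_Laplace_decay (s - e) ltac:(unfold s; lra)) as [K0 HK0].
      destruct (weighted_Laplace_decay (s + e) ltac:(unfold s; lra)) as [K1 HK1].
      apply (abs_int_of_power_bounds l K0 K1 e); [lra|apply continuous_weighted_Laplace| |]; intros t Ht.
      - replace (e - 1) with (s - 1 - (s - e)) by ring. apply HK0, Ht.
      - replace (- e - 1) with (s - 1 - (s + e)) by ring. apply HK1, Ht. }
  destruct primitive_integral as [H HH].
  destruct (weighted_norm_le s exponent_range) as [K [HK HKn]].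
  assert (HD : forall x, 0 < x -> is_derive H x (l x)).
  { intros x Hx. apply (is_derive_quadratic H (l x) x (x / 2) (M / (x / 2) ^ 2 * K)); [lra|].
    intros y Hy. apply Rabs_def2 in Hy.
    replace (M / (x / 2) ^ 2 * K * (y - x) ^ 2) with (M / (x / 2) ^ 2 * (y - x) ^ 2 * K) by ring.
    apply (HKn (fun t => primitive y t - primitive x t - (y - x) * kernel x t)).
    - apply Rmult_le_pos; [|apply pow2_ge_0]. left. apply Rdiv_lt_0_compat; [apply kernel_bound_pos|apply pow_lt; lra].
    - intros t Ht.
      apply (continuous_minus (fun t => primitive y t - primitive x t) (fun t => (y - x) * kernel x t)).
      + apply (continuous_minus (primitive y) (primitive x)); apply continuous_primitive; lra.
      + apply (continuous_scal_r (y - x) (kernel x)), continuous_kernel.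
    - intros t Ht. apply primitive_taylor; lra.
    - generalize (is_int_minus _ _ _ _ (is_int_minus _ _ _ _ (HH y ltac:(lra)) (HH x Hx))
        (is_int_scal _ (y - x) _ (is_int_weighted_Laplace x Hx))).
      apply is_int_ext. intros t _. vlinear V; ring. }
  destruct (Gamma_integral_rate s e ltac:(lra)) as [_ [G [HG0 HG]]].
  destruct (weighted_integral (s - e) (s + e) ltac:(unfold s; lra) ltac:(unfold s; lra)) as [K' [HK' HK'n]].
  (* The integral of [l] over [a, b] is [H b - H a]. Its distance to [Gamma s] times [I] is the
     integral of [g] against [t^(-s)] times the truncation error of the Gamma integral on the
     interval [a t, b t]. *)
  assert (Hrate : forall a b, 0 < a <= b ->
    norm (minus (RInt l a b) (scal (Gamma s) I)) <= (Rpower a e + Rpower b (- e)) * (G * K')).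
  { intros a b Hab.
    assert (E : RInt l a b = minus (H b) (H a)).
    { apply is_RInt_unique. apply (is_RInt_derive H l); intros t Ht; rewrite Rmin_left in Ht by lra.
      - apply HD; lra.
      - apply continuous_weighted_Laplace; lra. }
    set (k := fun t => primitive b t - primitive a t - Gamma s * Rpower t (- s)).
    destruct (HK'n k (G * (Rpower a e + Rpower b (- e)))) as [J [HJ HJn]].
    - apply Rmult_le_pos; [lra|]. assert (A1 := Rpower_pos a e). assert (A2 := Rpower_pos b (- e)). lra.
    - intros t Ht. apply (continuous_minus (fun t => primitive b t - primitive a t) (fun t => Gamma s * Rpower t (- s))).
      + apply (continuous_minus (primitive b) (primitive a)); apply continuous_primitive; lra.
      + apply (continuous_scal_r (Gamma s) (fun t => Rpower t (- s))), Hpow, Ht.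
    - intros t Ht. unfold k, primitive.
      replace (Rpower t (- s) * lower (b * t) - Rpower t (- s) * lower (a * t) - Gamma s * Rpower t (- s))
        with (Rpower t (- s) * (lower (b * t) - lower (a * t) - Gamma s)) by ring.
      rewrite lower_gamma_diff by (apply Rmult_lt_0_compat; lra).
      rewrite Rabs_mult, Rabs_pos_eq by (left; apply Rpower_pos).
      eapply Rle_trans.
      { apply Rmult_le_compat_l; [left; apply Rpower_pos|]. apply HG. split; [apply Rmult_lt_0_compat; lra|].
        apply Rmult_le_compat_r; lra. }
      rewrite <- !Rpower_mult_distr by lra.
      replace (- (s - e)) with (- s + e) by ring. replace (- (s + e)) with (- s + - e) by ring.
      rewrite !Rpower_plus.
      assert (A0 := Rpower_pos t (- s)). assert (A1 := Rpower_pos a e). assert (A2 := Rpower_pos b (- e)).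
      assert (A3 := Rpower_pos t e). assert (A4 := Rpower_pos t (- e)).
      replace (Rpower t (- s) * (G * (Rpower a e * Rpower t e + Rpower b (- e) * Rpower t (- e))))
        with (G * Rpower t (- s) * (Rpower a e * Rpower t e + Rpower b (- e) * Rpower t (- e))) by ring.
      replace (G * (Rpower a e + Rpower b (- e)) * (Rpower t (- s) * Rpower t e + Rpower t (- s) * Rpower t (- e)))
        with (G * Rpower t (- s) * ((Rpower a e + Rpower b (- e)) * (Rpower t e + Rpower t (- e)))) by ring.
      (* Expanding the larger product leaves two positive cross terms to drop. *)
      apply Rmult_le_compat_l; [apply Rmult_le_pos; lra|]. nra.
    - assert (EJ : minus (RInt l a b) (scal (Gamma s) I) = J).
      { rewrite E. rewrite <- (is_int_unique _ _ HJ). symmetry. apply is_int_unique.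
        generalize (is_int_minus _ _ _ _ (is_int_minus _ _ _ _ (HH b ltac:(lra)) (HH a ltac:(lra)))
          (is_int_scal _ (Gamma s) _ HI)).
        apply is_int_ext. intros t _. unfold k. vlinear V; ring. }
      rewrite EJ. apply Rle_trans with (1 := HJn). right. ring. }
  apply is_RInt_gen_filterlim; [apply continuous_weighted_Laplace|].
  assert (Hlim : filterlim (fun ab => minus (RInt l (fst ab) (snd ab)) (scal (Gamma s) I))
    (filter_prod (at_right 0) (Rbar_locally p_infty)) (locally (zero : V))).
  { apply (filterlim_zero_norm_le _ _ (fun ab => (G * K') * (Rpower (fst ab) e + Rpower (snd ab) (- e)))).
    - generalize half_line_ordered. apply filter_imp. intros ab Hab.
      rewrite Rmult_comm. apply Hrate, Hab.
    - apply filterlim_scal_zero.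
      assert (E : filterlim (fun ab => Rpower (fst ab) e + Rpower (snd ab) (- e))
        (filter_prod (at_right 0) (Rbar_locally p_infty)) (locally (0 + 0))).
      { eapply (filterlim_comp_2 (G := locally 0) (H := locally 0)).
        - apply (filterlim_comp _ _ _ fst (fun a => Rpower a e) _ (at_right 0)); [apply filterlim_fst|].
          apply Rpower_filterlim_0. lra.
        - apply (filterlim_comp _ _ _ snd (fun b => Rpower b (- e)) _ (Rbar_locally p_infty)); [apply filterlim_snd|].
          apply Rpower_filterlim_infty. lra.
        - apply (filterlim_plus (K := R_AbsRing) (V := R_NormedModule) 0 0). }
      rewrite Rplus_0_l in E. exact E. }
  assert (Hlim' : filterlim (fun ab => plus (minus (RInt l (fst ab) (snd ab)) (scal (Gamma s) I)) (scal (Gamma s) I))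
    (filter_prod (at_right 0) (Rbar_locally p_infty)) (locally (plus (zero : V) (scal (Gamma s) I)))).
  { eapply (filterlim_comp_2 (G := locally (zero : V)) (H := locally (scal (Gamma s) I : V))).
    - exact Hlim.
    - apply filterlim_const.
    - apply (filterlim_plus (zero : V) (scal (Gamma s) I)). }
  assert (Ez : plus (zero : V) (scal (Gamma s) I) = scal (Gamma s) I) by (vlinear V; ring).
  refine (eq_ind _ (fun y => filterlim _ _ (locally (y : V))) _ _ Ez).
  refine (filterlim_ext _ _ _ Hlim'). intros ab. vlinear V; ring.
Qed.

End MomentFormula.

(** * Integrated orbits *)

Section IntegratedOrbit.

Context {V : CompleteNormedModule R_AbsRing}.

(** Taking [q = a + 1/2] and [q = a + 3/2] meets the convergence criterion with [p = 1/2]. *)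
Lemma exp_decay_bounds (h : R -> V) (a C x : R) :
  0 <= a -> 0 < x -> (forall t, 0 < t -> norm (h t) <= C * Rpower t a) ->
  exists C', forall t, 0 < t ->
    norm (scal (exp (- (x * t))) (h t)) <= C' * Rpower t (/ 2 - 1) /\
    norm (scal (exp (- (x * t))) (h t)) <= C' * Rpower t (- / 2 - 1).
Proof.
  intros Ha Hx Hh.
  assert (HC : 0 <= C).
  { assert (H1 := Hh 1 Rlt_0_1). assert (H2 := norm_ge_0 (h 1)). assert (H3 := Rpower_pos 1 a). nra. }
  assert (E : forall q t, 0 < q -> 0 < t ->
    norm (scal (exp (- (x * t))) (h t)) <= Rpower q q * Rpower x (- q) * C * Rpower t (a - q)).
  { intros q t Hq Ht. rewrite norm_scal_eq, Rabs_pos_eq by (left; apply exp_pos).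
    assert (H := exp_neg_le_Rpower q (x * t) Hq ltac:(apply Rmult_lt_0_compat; assumption)).
    rewrite <- Rpower_mult_distr in H by assumption.
    replace (a - q) with (- q + a) by ring. rewrite Rpower_plus.
    replace (Rpower q q * Rpower x (- q) * C * (Rpower t (- q) * Rpower t a))
      with (Rpower q q * (Rpower x (- q) * Rpower t (- q)) * (C * Rpower t a)) by ring.
    apply Rmult_le_compat; [left; apply exp_pos|apply norm_ge_0|exact H|apply Hh, Ht]. }
  set (K := fun q => Rpower q q * Rpower x (- q) * C).
  exists (Rmax (K (a + / 2)) (K (a + 3 / 2))). intros t Ht. split.
  - eapply Rle_trans; [apply (E (a + / 2)); lra|].
    replace (a - (a + / 2)) with (/ 2 - 1) by field.
    apply Rmult_le_compat_r; [left; apply Rpower_pos|apply Rmax_l].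
  - eapply Rle_trans; [apply (E (a + 3 / 2)); lra|].
    replace (a - (a + 3 / 2)) with (- / 2 - 1) by field.
    apply Rmult_le_compat_r; [left; apply Rpower_pos|apply Rmax_r].
Qed.

Lemma continuous_exp_scal (h : R -> V) (x t : R) :
  continuous h t -> continuous (fun t => scal (exp (- (x * t))) (h t)) t.
Proof.
  intros H. apply (continuous_scal (fun t => exp (- (x * t))) h); [apply continuous_exp_scaled|exact H].
Qed.

Lemma Laplace_converges (h : R -> V) (a C x : R) :
  0 <= a -> 0 < x -> (forall t, 0 < t -> continuous h t) ->
  (forall t, 0 < t -> norm (h t) <= C * Rpower t a) ->
  exists l : V, is_int (fun t => scal (exp (- (x * t))) (h t)) l.
Proof.
  intros Ha Hx Hc Hh. destruct (exp_decay_bounds h a C x Ha Hx Hh) as [C' HC'].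
  destruct (power_dominated_norm_le (fun t => scal (exp (- (x * t))) (h t)) C' C' (/ 2)) as [l [Hl _]].
  - lra.
  - intros t Ht. apply continuous_exp_scal, Hc, Ht.
  - intros t Ht. apply HC', Ht.
  - intros t Ht. apply HC', Ht.
  - exists l. exact Hl.
Qed.

Lemma is_derive_scal_fun (k : R -> R) (h : R -> V) (x k' : R) (h' : V) :
  is_derive k x k' -> is_derive h x h' ->
  is_derive (fun t => scal (k t) (h t)) x (plus (scal k' (h x)) (scal (k x) h')).
Proof.
  intros Hk Hh. unfold is_derive.
  eapply filterdiff_ext_lin.
  - apply (@filterdiff_scal_fct R_AbsRing R_NormedModule V x k h _ _ Rmult_comm Hk Hh).
  - intros y. change (plus (scal (y * k') (h x)) (scal (k x) (scal y h'))
      = scal y (plus (scal k' (h x)) (scal (k x) h'))). vlinear V; ring.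
Qed.

Lemma Laplace_primitive (u : R -> V) (a C x : R) (l : V) :
  0 <= a -> 0 < x -> (forall t, continuous u t) ->
  (forall t, 0 < t -> norm (RInt u 0 t) <= C * Rpower t (a + 1)) ->
  is_int (fun t => scal (exp (- (x * t))) (u t)) l ->
  is_int (fun t => scal (exp (- (x * t))) (RInt u 0 t)) (scal (/ x) l).
Proof.
  intros Ha Hx Hu HU Hl. set (U := fun t => RInt u 0 t).
  assert (HD : forall t, is_derive U t (u t)).
  { intros t. apply (is_derive_RInt u U 0 t); [|apply Hu].
    apply filter_forall. intros y. apply (RInt_correct u). apply (ex_RInt_continuous u). auto. }
  assert (HUc : forall t, continuous U t).
  { intros t. apply (ex_derive_continuous U). eexists. apply HD. }
  (* The exact derivative of [exp (- (x * t)) U t] integrates to zero; the bound [t^(a+1)] handles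
     the end 0, and the exponential bound with [q = a + 2] leaves [t^(-1)] at infinity. *)
  assert (H1 : is_int (fun t => plus (scal (- x * exp (- (x * t))) (U t)) (scal (exp (- (x * t))) (u t)))
    (minus zero zero)).
  { apply (is_int_derive (fun t => scal (exp (- (x * t))) (U t))).
    - intros t _. apply (is_derive_scal_fun (fun t => exp (- (x * t))) U t (- x * exp (- (x * t))) (u t)); [|apply HD]. auto_derive; [exact I|ring].
    - intros t _. apply (continuous_plus (fun t => scal (- x * exp (- (x * t))) (U t)) (fun t => scal (exp (- (x * t))) (u t))).
      + apply (continuous_scal (fun t => - x * exp (- (x * t))) U); [|apply HUc].
        apply (ex_derive_continuous (fun t => - x * exp (- (x * t)))). auto_derive. exact I.
      + apply continuous_exp_scal, Hu.
    - apply (filterlim_zero_Rpower_0 _ C (a + 1)); [lra|]. intros t Ht.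
      rewrite norm_scal_eq, Rabs_pos_eq by (left; apply exp_pos).
      rewrite <- (Rmult_1_l (C * _)). apply Rmult_le_compat; [left; apply exp_pos|apply norm_ge_0| |apply HU, Ht].
      rewrite <- exp_0. left. apply exp_increasing. assert (0 < x * t) by (apply Rmult_lt_0_compat; assumption). lra.
    - apply (filterlim_zero_Rpower_infty _ (Rpower (a + 2) (a + 2) * Rpower x (- (a + 2)) * C) 1); [lra|]. intros t Ht.
      rewrite norm_scal_eq, Rabs_pos_eq by (left; apply exp_pos).
      assert (H := exp_neg_le_Rpower (a + 2) (x * t) ltac:(lra) ltac:(apply Rmult_lt_0_compat; assumption)).
      rewrite <- Rpower_mult_distr in H by assumption.
      replace (- (1)) with (- (a + 2) + (a + 1)) by ring. rewrite (Rpower_plus (- (a + 2)) (a + 1) t).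
      replace (Rpower (a + 2) (a + 2) * Rpower x (- (a + 2)) * C * (Rpower t (- (a + 2)) * Rpower t (a + 1)))
        with (Rpower (a + 2) (a + 2) * (Rpower x (- (a + 2)) * Rpower t (- (a + 2))) * (C * Rpower t (a + 1))) by ring.
      apply Rmult_le_compat; [left; apply exp_pos|apply norm_ge_0|exact H|apply HU, Ht]. }
  generalize (is_int_scal _ (/ x) _ (is_int_minus _ _ _ _ Hl H1)).
  apply is_int_congr.
  - intros t _. fold (U t). vlinear V; field; lra.
  - vlinear V; ring.
Qed.

Lemma norm_RInt_0_le (u : R -> V) (a C t : R) :
  0 <= a -> 0 < t -> (forall t, continuous u t) ->
  (forall t, 0 < t -> norm (u t) <= C * Rpower t a) ->
  norm (RInt u 0 t) <= C * Rpower t (a + 1).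
Proof.
  intros Ha Ht Hu Hb.
  assert (HC : 0 <= C).
  { assert (H1 := Hb 1 Rlt_0_1). assert (H2 := norm_ge_0 (u 1)). assert (H3 := Rpower_pos 1 a). nra. }
  assert (Hb' : forall y, 0 < y <= t -> norm (u y) <= C * Rpower t a).
  { intros y Hy. apply Rle_trans with (1 := Hb y (proj1 Hy)).
    apply Rmult_le_compat_l; [exact HC|]. apply Rle_Rpower_l; lra. }
  rewrite Rpower_add_1 by exact Ht.
  replace (C * (t * Rpower t a)) with ((t - 0) * (C * Rpower t a)) by ring.
  apply (norm_RInt_le_const u 0 t); [lra| |].
  - intros y Hy. destruct (Req_dec y 0) as [-> | Hy0]; [|apply Hb'; lra].
    (* The bound extends to 0 by continuity. *)
    apply Rnot_lt_le. intros Hlt.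
    assert (He : 0 < norm (u 0) - C * Rpower t a) by lra.
    destruct (proj1 (filterlim_locally _ _) (continuous_norm u 0 (Hu 0)) (mkposreal _ He)) as [d Hd].
    assert (Hd0 := cond_pos d).
    assert (Hm : 0 < Rmin (d / 2) t) by (apply Rmin_case; lra).
    assert (M1 := Rmin_l (d / 2) t). assert (M2 := Rmin_r (d / 2) t).
    assert (Hball : ball 0 d (Rmin (d / 2) t)).
    { change (Rabs (Rmin (d / 2) t - 0) < d). rewrite Rminus_0_r, Rabs_pos_eq; lra. }
    specialize (Hd _ Hball). change (Rabs (norm (u (Rmin (d / 2) t)) - norm (u 0)) < norm (u 0) - C * Rpower t a) in Hd.
    apply Rabs_def2 in Hd. specialize (Hb' (Rmin (d / 2) t) (conj Hm M2)). lra.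
  - apply (RInt_correct u). apply (ex_RInt_continuous u). auto.
Qed.

(* By the resolvent identity [x * R f - R h = f], where [R v = x^alpha * Lv], the
   functions [g] and [fun t => RInt uh 0 t] have the same Laplace transform, so they
   agree; this is what makes [g] small at 0. *)
Lemma integrated_orbit (alpha C : R) (uf uh : R -> V) (f : V) (Lf Lh : R -> V) :
  0 <= alpha ->
  (forall t, continuous uf t) -> (forall t, continuous uh t) ->
  (forall t, 0 < t -> norm (uf t) <= C * Rpower t alpha) ->
  (forall t, 0 < t -> norm (uh t) <= C * Rpower t alpha) ->
  (forall x, 0 < x -> is_int (fun t => scal (exp (- (x * t))) (uf t)) (Lf x)) ->
  (forall x, 0 < x -> is_int (fun t => scal (exp (- (x * t))) (uh t)) (Lh x)) ->
  (forall x, 0 < x -> minus (scal x (scal (Rpower x alpha) (Lf x))) (scal (Rpower x alpha) (Lh x)) = f) ->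
  let g := fun t => minus (uf t) (scal (Rpower t alpha / Gamma (alpha + 1)) f) in
  (forall t, 0 < t -> continuous g t) /\
  (exists C', 0 <= C' /\ (forall t, 0 < t -> norm (g t) <= C' * Rpower t (alpha + 1)) /\
    (forall t, 0 < t -> norm (g t) <= C' * Rpower t alpha)) /\
  (forall x, 0 < x -> is_int (fun t => scal (exp (- (x * t))) (g t)) (scal (/ x) (Lh x))).
Proof.
  intros Ha Huf Huh Hbf Hbh HLf HLh Hres g.
  assert (HG := Gamma_gt_0 (alpha + 1) ltac:(lra)).
  assert (Hgc : forall t, 0 < t -> continuous g t).
  { intros t Ht. apply (continuous_minus uf (fun t => scal (Rpower t alpha / Gamma (alpha + 1)) f)); [apply Huf|].
    apply (continuous_scal_l (V := V) (fun t => Rpower t alpha / Gamma (alpha + 1))).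
    apply (continuous_mult (fun t => Rpower t alpha) (fun _ => / Gamma (alpha + 1)));
      [apply continuous_Rpower, Ht|apply continuous_const]. }
  set (D := C + norm f / Gamma (alpha + 1)).
  assert (Hgb : forall t, 0 < t -> norm (g t) <= D * Rpower t alpha).
  { intros t Ht. unfold g, minus. eapply Rle_trans; [apply (norm_triangle (uf t))|].
    rewrite (norm_opp_complete (scal _ f)), (norm_scal_eq _ f), Rabs_pos_eq
      by (left; apply Rdiv_lt_0_compat; [apply Rpower_pos|exact HG]).
    specialize (Hbf t Ht).
    replace (D * Rpower t alpha) with (C * Rpower t alpha + Rpower t alpha / Gamma (alpha + 1) * norm f)
      by (unfold D; field; lra). lra. }
  assert (HUb : forall t, 0 < t -> norm (RInt uh 0 t) <= C * Rpower t (alpha + 1)).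
  { intros t Ht. apply norm_RInt_0_le; assumption. }
  assert (HUc : forall t, continuous (fun t => RInt uh 0 t) t).
  { intros t. apply (ex_derive_continuous (fun t => RInt uh 0 t)). exists (uh t).
    apply (is_derive_RInt uh (fun t => RInt uh 0 t) 0 t); [|apply Huh].
    apply filter_forall. intros y. apply (RInt_correct uh). apply (ex_RInt_continuous uh). auto. }
  assert (HLU : forall x, 0 < x -> is_int (fun t => scal (exp (- (x * t))) (RInt uh 0 t)) (scal (/ x) (Lh x))).
  { intros x Hx. apply Laplace_primitive with (a := alpha) (C := C); auto. }
  assert (HLg : forall x, 0 < x -> is_int (fun t => scal (exp (- (x * t))) (g t)) (scal (/ x) (Lh x))).
  { intros x Hx.
    (* The transform of [t^alpha / Gamma (alpha + 1)] is [x^(-alpha-1)], so [Hres] divided by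
       [x^(alpha+1)] is exactly the required value. *)
    assert (H := is_int_scal_l (V := V) _ f _ (Laplace_Rpower alpha x ltac:(lra) Hx)).
    generalize (is_int_minus _ _ _ _ (HLf x Hx) (is_int_scal _ (/ Gamma (alpha + 1)) _ H)).
    apply is_int_congr.
    - intros t _. unfold g. vlinear V; field; lra.
    - rewrite <- (Hres x Hx).
      replace (- alpha - 1) with (- (alpha + 1)) by ring. rewrite Rpower_Ropp, Rpower_add_1 by exact Hx.
      assert (HP := Rpower_pos x alpha). vlinear V; field; repeat split; lra. }
  assert (HgU : forall t, 0 < t -> g t = RInt uh 0 t).
  { destruct (exp_decay_bounds g alpha D 1 Ha Rlt_0_1 Hgb) as [D1 HD1].
    destruct (exp_decay_bounds (fun t => RInt uh 0 t) (alpha + 1) C 1 ltac:(lra) Rlt_0_1 HUb) as [D2 HD2].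
    (* The factor [exp (- t)] makes both functions integrable and moves the nonnegative integers [k]
       to the positive points [k + 1], where the transforms are known. *)
    assert (Hz : forall t, 0 < t ->
      minus (scal (exp (- (1 * t))) (g t)) (scal (exp (- (1 * t))) (RInt uh 0 t)) = zero).
    { assert (Htri : forall a b : V, norm (minus a b) <= norm a + norm b).
      { intros a b. rewrite <- (norm_opp_complete b). apply (norm_triangle a). }
      apply (Laplace_uniqueness (fun t => minus (scal (exp (- (1 * t))) (g t)) (scal (exp (- (1 * t))) (RInt uh 0 t)))
        (D1 + D2) (D1 + D2) (/ 2)).
      - lra.
      - intros t Ht. apply (continuous_minus (fun t => scal (exp (- (1 * t))) (g t)) (fun t => scal (exp (- (1 * t))) (RInt uh 0 t)));
          apply continuous_exp_scal; auto.
      - intros t Ht. eapply Rle_trans; [apply Htri|]. destruct (HD1 t Ht), (HD2 t Ht). lra.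
      - intros t Ht. eapply Rle_trans; [apply Htri|]. destruct (HD1 t Ht), (HD2 t Ht). lra.
      - intros k. assert (Hk := pos_INR k).
        generalize (is_int_minus _ _ _ _ (HLg (INR k + 1) ltac:(lra)) (HLU (INR k + 1) ltac:(lra))).
        apply is_int_congr; [|vlinear V; ring].
        intros t _. replace (- ((INR k + 1) * t)) with (- (INR k * t) + - (1 * t)) by ring.
        rewrite exp_plus. vlinear V; ring. }
    intros t Ht. specialize (Hz t Ht).
    assert (HE := exp_pos (- (1 * t))).
    assert (E : minus (g t) (RInt uh 0 t) = scal (/ exp (- (1 * t)))
      (minus (scal (exp (- (1 * t))) (g t)) (scal (exp (- (1 * t))) (RInt uh 0 t)))).
    { vlinear V; field; lra. }
    rewrite Hz in E.
    transitivity (plus (minus (g t) (RInt uh 0 t)) (RInt uh 0 t)); [vlinear V; ring|].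
    rewrite E. vlinear V; ring. }
  split; [exact Hgc|]. split; [|exact HLg].
  exists (Rmax 0 (Rmax C D)).
  assert (M0 := Rmax_l 0 (Rmax C D)). assert (M1 := Rmax_r 0 (Rmax C D)).
  assert (M2 := Rmax_l C D). assert (M3 := Rmax_r C D).
  split; [exact M0|]. split; intros t Ht.
  - rewrite HgU by exact Ht. eapply Rle_trans; [apply HUb, Ht|].
    apply Rmult_le_compat_r; [left; apply Rpower_pos|lra].
  - eapply Rle_trans; [apply Hgb, Ht|].
    apply Rmult_le_compat_r; [left; apply Rpower_pos|lra].
Qed.

End IntegratedOrbit.

(** * The generator on a complex space *)

Section ComplexSpace.

Context {X : CompleteNormedModule C_AbsRing}.

Lemma op_norm_le (S : X -> X) (v : X) :
  is_linear S -> norm (S v) <= op_norm S * norm v.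
Proof.
  intros HS.
  set (E := fun r : R => exists x : X, norm x <= 1 /\ r = norm (S x)).
  destruct (linear_norm S HS) as [M [HM HMn]].
  (* [real] sends infinite values to 0, so [op_norm] is meaningful only once the supremum is finite:
     boundedness of [S] excludes one infinity, the vector [zero] the other. *)
  assert (Hfin : Lub_Rbar E = Finite (op_norm S)).
  { assert (HL := Lub_Rbar_correct E). destruct HL as [Hub Hlub].
    assert (U : Rbar_le (Lub_Rbar E) (Finite M)).
    { apply Hlub. intros r [x [Hx ->]]. simpl. apply Rle_trans with (1 := HMn x). nra. }
    assert (L : Rbar_le (Finite (norm (S zero))) (Lub_Rbar E)).
    { apply Hub. exists zero. split; [|reflexivity].
      apply Rle_trans with 0; [right; apply (@norm_zero C_AbsRing X)|lra]. }
    unfold op_norm. fold E. destruct (Lub_Rbar E); simpl in *; [reflexivity|contradiction|contradiction]. }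
  assert (Hub : forall x : X, norm x <= 1 -> norm (S x) <= op_norm S).
  { intros x Hx. assert (H := proj1 (Lub_Rbar_correct E) (norm (S x))).
    rewrite Hfin in H. simpl in H. apply H. exists x. auto. }
  destruct (Req_dec (norm v) 0) as [Hv | Hv].
  - assert (Ev : v = zero) by (apply (@norm_eq_zero C_AbsRing X), Hv).
    rewrite Hv, Rmult_0_r. right. transitivity (norm (zero : X)); [|apply (@norm_zero C_AbsRing X)].
    f_equal. rewrite Ev. apply (linear_zero S HS).
  - assert (Hv0 : 0 < norm v) by (assert (H := norm_ge_0 v); lra).
    set (y := scal (RtoC (/ norm v)) v : X).
    assert (Hy : norm y <= 1).
    { eapply Rle_trans; [apply (@norm_scal C_AbsRing X)|].
      change (abs (RtoC (/ norm v))) with (Cmod (RtoC (/ norm v))).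
      rewrite Cmod_R, Rabs_pos_eq by (left; apply Rinv_0_lt_compat, Hv0).
      rewrite Rinv_l; lra. }
    assert (Ev : v = scal (RtoC (norm v)) y).
    { unfold y. rewrite real_scal_assoc, Rinv_r by exact Hv. symmetry. apply real_scal_one. }
    rewrite Ev at 1. rewrite (linear_scal S HS).
    eapply Rle_trans; [apply (@norm_scal C_AbsRing X)|].
    change (abs (RtoC (norm v))) with (Cmod (RtoC (norm v))).
    rewrite Cmod_R, Rabs_pos_eq, Rmult_comm by lra.
    apply Rmult_le_compat_r; [lra|apply Hub, Hy].
Qed.

Lemma tempered_bound (alpha : R) (T : R -> X -> X) :
  tempered_family alpha T ->
  exists M, 0 <= M /\ forall t v, 0 < t -> norm (T t v) <= M * norm v * Rpower t alpha.
Proof.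
  intros [HT [_ [M HM]]]. exists (Rmax 0 M). split; [apply Rmax_l|].
  intros t v Ht. apply Rle_trans with (1 := op_norm_le (T t) v (HT t (Rlt_le _ _ Ht))).
  specialize (HM t Ht). rewrite Rpower_Ropp in HM.
  assert (HP := Rpower_pos t alpha). assert (Hv := norm_ge_0 v).
  assert (H : op_norm (T t) <= Rmax 0 M * Rpower t alpha).
  { apply Rmult_le_reg_l with (/ Rpower t alpha); [apply Rinv_0_lt_compat, HP|].
    apply Rle_trans with (1 := HM). apply Rle_trans with (1 := Rmax_r 0 M). right. field. lra. }
  apply Rle_trans with (Rmax 0 M * Rpower t alpha * norm v).
  - apply Rmult_le_compat_r; assumption.
  - right. ring.
Qed.

(* [T t v] is only controlled for [t >= 0]; freezing it at [T 0 v] for negative times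
   gives a function continuous on the whole line. *)
Definition orbit (T : R -> X -> X) (v : X) (t : R) : real_space X := T (Rmax 0 t) v.

Lemma orbit_pos (T : R -> X -> X) (v : X) (t : R) : 0 < t -> orbit T v t = T t v.
Proof. intros Ht. unfold orbit. rewrite Rmax_right by lra. reflexivity. Qed.

Lemma continuous_orbit (alpha : R) (T : R -> X -> X) (v : X) (t : R) :
  tempered_family alpha T -> continuous (orbit T v) t.
Proof.
  intros [_ [HT _]]. specialize (HT v).
  apply (filterlim_comp _ _ _ (Rmax 0) (fun t => T t v) (locally t)
    (within (fun t => 0 <= t) (locally (Rmax 0 t)))).
  - intros P [e He]. exists e. intros y Hy. apply He; [|apply Rmax_l].
    change (Rabs (y - t) < e) in Hy. change (Rabs (Rmax 0 y - Rmax 0 t) < e).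
    apply Rle_lt_trans with (2 := Hy).
    unfold Rmax. destruct (Rle_dec 0 y), (Rle_dec 0 t); unfold Rabs;
      repeat destruct Rcase_abs; lra.
  - apply HT. apply Rmax_l.
Qed.

Lemma Cpower_RtoC (x a : R) : 0 < x -> Cpower (RtoC x) a = RtoC (Rpower x a).
Proof.
  intros Hx. unfold Cpower, Cexp. rewrite Cmod_R, Rabs_pos_eq by lra. simpl.
  unfold Rdiv. rewrite Rmult_0_l, atan_0, Rmult_0_r, cos_0, sin_0, Rmult_1_r, Rmult_0_r.
  reflexivity.
Qed.

Lemma Cexp_RtoC (x t : R) : Cexp (- (RtoC x * RtoC t))%C = RtoC (exp (- (x * t))).
Proof.
  unfold Cexp, RtoC, Re, Im; simpl.
  replace (- (x * t - 0 * 0)) with (- (x * t)) by ring.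
  replace (- (x * 0 + 0 * t)) with 0 by ring.
  rewrite cos_0, sin_0, Rmult_1_r, Rmult_0_r. reflexivity.
Qed.

(** The resolvent is a unique description with no linearity built in. It agrees with the bounded
    inverse [S], because [S] is a left inverse, and inherits linearity from it. *)
Lemma resolvent_inverse (A : operator X) (lambda : C) :
  in_resolvent_set A lambda ->
  (forall v, resolvent A lambda (opp v) = opp (resolvent A lambda v)) /\
  (forall u, dom A u ->
    minus (scal lambda (resolvent A lambda u)) (resolvent A lambda (A u)) = u).
Proof.
  intros Hr. assert (Hspec := fun v => resolvent_spec A lambda v Hr).
  destruct Hr as [S [HS [_ HSl]]].
  assert (E : forall v, resolvent A lambda v = S v).
  { intros v. destruct (Hspec v) as [H1 H2].
    transitivity (S (minus (scal lambda (resolvent A lambda v)) (A (resolvent A lambda v)))).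
    - symmetry. apply HSl, H1.
    - f_equal. exact H2. }
  split.
  - intros v. rewrite !E. apply (linear_opp S v HS).
  - intros u Hu. rewrite !E.
    transitivity (S (minus (scal lambda u) (A u))); [|apply HSl, Hu].
    symmetry. etransitivity; [apply (linear_minus S _ _ HS)|]. f_equal. apply (linear_scal S HS).
Qed.

(** The definition of the generator equates the resolvent with the value of a total integral
    operator; that this integral converges is deduced here from the growth bound on [T]. *)
Lemma generator_Laplace (alpha : R) (A : operator X) (T : R -> X -> X) (v : X) :
  0 <= alpha -> generates_tempered alpha A T ->
  exists Lv : R -> real_space X, forall x, 0 < x ->
    is_int (fun t => scal (exp (- (x * t))) (orbit T v t)) (Lv x) /\
    resolvent A (RtoC x) v = (scal (Rpower x alpha) (Lv x) : real_space X).
Proof.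
  intros Ha [HT [_ [_ Hres]]].
  destruct (tempered_bound alpha T HT) as [M [HM HTb]].
  exists (fun x => RInt_gen (fun t => scal (exp (- (x * t))) (orbit T v t)) (at_right 0) (Rbar_locally p_infty)).
  intros x Hx.
  assert (HI : is_int (fun t => scal (exp (- (x * t))) (orbit T v t))
    (RInt_gen (fun t => scal (exp (- (x * t))) (orbit T v t)) (at_right 0) (Rbar_locally p_infty))).
  { apply (RInt_gen_correct (fun t => scal (exp (- (x * t))) (orbit T v t))).
    apply (Laplace_converges (orbit T v) alpha (M * norm v) x Ha Hx).
    - intros t _. apply (continuous_orbit alpha), HT.
    - intros t Ht. rewrite orbit_pos by exact Ht. apply HTb, Ht. }
  split; [exact HI|].
  destruct (Hres (RtoC x) Hx) as [_ H]. rewrite H, Cpower_RtoC by exact Hx.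
  change (scal (RtoC (Rpower x alpha)) (integral (fun t : R => scal (Cexp (- (RtoC x * RtoC t))) (T t v)))
    = scal (RtoC (Rpower x alpha)) (RInt_gen (V := real_space X) (fun t => scal (exp (- (x * t))) (orbit T v t)) (at_right 0) (Rbar_locally p_infty) : X)).
  f_equal. apply (is_int_unique (V := real_space X)). revert HI. apply (is_int_ext (V := real_space X)).
  intros t Ht. rewrite orbit_pos by exact Ht. rewrite Cexp_RtoC. reflexivity.
Qed.

End ComplexSpace.

Theorem theorem4p1 (X : CompleteNormedModule C_AbsRing) (alpha : R) (halpha : 0 <= alpha)
    (A : operator X) (T : R -> X -> X) (hA : generates_tempered alpha A T)
    (sigma : R) (hsigma : 0 < sigma < 1) (f : X) (hf : dom A f) :
  let integrand := fun t : R =>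
    scal (RtoC (/ Rpower t (sigma + alpha + 1)))
      (minus (T t f) (scal (RtoC (Rpower t alpha / Gamma (alpha + 1))) f)) in
  abs_convergent (balakrishnan_integrand A sigma f) /\
  abs_convergent integrand /\
  frac_power A sigma f =
    scal (RtoC (Gamma (sigma + alpha + 1) / (Gamma (- sigma) * Gamma (1 + sigma))))
      (integral integrand).
Proof.
  intros integrand.
  destruct (generator_Laplace alpha A T f halpha hA) as [Lf HLf].
  destruct (generator_Laplace alpha A T (A f) halpha hA) as [Lh HLh].
  assert (hA' := hA). destruct hA' as [HT [_ [_ Hres]]].
  destruct (tempered_bound alpha T HT) as [M [HM HTb]].
  set (s := sigma + alpha + 1).
  (* One constant has to serve the orbits of both [f] and [A f]. *)
  set (C := M * Rmax (norm f) (norm (A f))).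
  assert (Hbound : forall v, norm v <= Rmax (norm f) (norm (A f)) ->
    forall t, 0 < t -> norm (orbit T v t) <= C * Rpower t alpha).
  { intros v Hv t Ht. rewrite orbit_pos by exact Ht. apply Rle_trans with (1 := HTb t v Ht).
    apply Rmult_le_compat_r; [left; apply Rpower_pos|]. apply Rmult_le_compat_l; assumption. }
  destruct (integrated_orbit (V := real_space X) alpha C (orbit T f) (orbit T (A f)) f Lf Lh) as [Hgc [[D [HD [HgD1 HgD0]]] HgL]].
  { exact halpha. }
  { intros t. apply (continuous_orbit alpha), HT. }
  { intros t. apply (continuous_orbit alpha), HT. }
  { apply Hbound, Rmax_l. }
  { apply Hbound, Rmax_r. }
  { intros x Hx. apply HLf, Hx. }
  { intros x Hx. apply HLh, Hx. }
  { intros x Hx. destruct (resolvent_inverse A (RtoC x) (proj1 (Hres (RtoC x) Hx))) as [_ H].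
    specialize (H f hf). rewrite (proj2 (HLf x Hx)), (proj2 (HLh x Hx)) in H. exact H. }
  set (g := fun t => minus (orbit T f t) (scal (Rpower t alpha / Gamma (alpha + 1)) (f : real_space X)) : real_space X) in *.
  destruct (Laplace_moment_formula (V := real_space X) alpha sigma D g (fun x => scal (/ x) (Lh x)) halpha hsigma HD Hgc HgD1 HgD0 HgL)
    as [I [HI [HIn [HB HBn]]]].
  fold s in HI, HIn, HB, HBn.
  assert (Eint : forall t, 0 < t -> scal (Rpower t (- s)) (g t) = (integrand t : real_space X)).
  { intros t Ht. unfold integrand, g. rewrite orbit_pos by exact Ht. rewrite Rpower_Ropp. reflexivity. }
  assert (Ebal : forall x, 0 < x ->
    opp (scal (Rpower x (s - 1)) (scal (/ x) (Lh x))) = (balakrishnan_integrand A sigma f x : real_space X)).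
  { intros x Hx. unfold balakrishnan_integrand.
    destruct (resolvent_inverse A (RtoC x) (proj1 (Hres (RtoC x) Hx))) as [H _].
    rewrite H, (proj2 (HLh x Hx)).
    change (opp (scal (Rpower x (s - 1)) (scal (/ x) (Lh x)))
      = scal (Rpower x (sigma - 1)) (opp (scal (Rpower x alpha) (Lh x)))).
    replace (s - 1) with (sigma - 1 + alpha + 1) by (unfold s; ring).
    rewrite Rpower_add_1, Rpower_plus by exact Hx. vlinear (real_space X). field. lra. }
  assert (HI' : is_RInt_gen (V := real_space X) integrand (at_right 0) (Rbar_locally p_infty) I).
  { revert HI. apply (is_int_ext (V := real_space X)), Eint. }
  assert (HB' : is_RInt_gen (V := real_space X) (balakrishnan_integrand A sigma f)
    (at_right 0) (Rbar_locally p_infty) (opp (scal (Gamma s) I))).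
  { generalize (is_RInt_gen_opp _ _ HB). apply (is_int_ext (V := real_space X)), Ebal. }
  split; [|split].
  - split; [eexists; exact HB'|]. destruct HBn as [n Hn]. exists n. revert Hn.
    apply (is_int_ext (V := R_CompleteNormedModule)). intros x Hx.
    rewrite <- (norm_opp_complete (V := real_space X)). exact (f_equal (fun y : real_space X => norm y) (Ebal x Hx)).
  - split; [eexists; exact HI'|]. destruct HIn as [n Hn]. exists n. revert Hn.
    apply (is_int_ext (V := R_CompleteNormedModule)). intros x Hx. exact (f_equal (fun y : real_space X => norm y) (Eint x Hx)).
  - unfold frac_power.
    replace (integral (balakrishnan_integrand A sigma f)) with (opp (scal (Gamma s) I) : X)
      by (symmetry; exact (is_int_unique (V := real_space X) _ _ HB')).
    replace (integral integrand) with (I : X)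
      by (symmetry; exact (is_int_unique (V := real_space X) _ _ HI')).
    (* Scaling by a real number in [real_space X] is by definition complex scaling through [RtoC],
       so the claim becomes a real linear identity. *)
    change (scal (sin (PI * sigma) / PI) (opp (scal (Gamma s) I))
      = scal (Gamma s / (Gamma (- sigma) * Gamma (1 + sigma))) I :> real_space X).
    assert (HPI := PI_RGT_0).
    assert (Hsin : 0 < sin (PI * sigma)) by (apply sin_gt_0; nra).
    (* Extending Gamma to [- sigma] divides by a negative number; this sign cancels the [opp]
       inherited from [- A f]. *)
    assert (E : Gamma (- sigma) * Gamma (1 + sigma) = - (PI / sin (PI * sigma))).
    { rewrite Gamma_neg by lra. replace (- sigma + 1) with (1 - sigma) by ring.
      replace (Gamma (1 - sigma) / - sigma * Gamma (1 + sigma))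
        with (- (Gamma (1 + sigma) * Gamma (1 - sigma) / sigma)) by (field; lra).
      rewrite Gamma_reflection by exact hsigma. field. lra. }
    rewrite E. vlinear (real_space X). field. lra.
Qed.
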